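(* Let $E$ be a complex Banach lattice which is monotonically complete and has the Fatou property. Let $(T_t)_{t \in [0,\infty)}$ be a positive and contractive $C_0$-semigroup on $E$ with generator $A$. If $i\beta \in i\mathbb{R}$ is an eigenvalue of $A$, then so is $ik\beta$ for each integer $k \in \mathbb{Z}$.
   Context: A complex Banach lattice $E$ is the Banach lattice complexification of a real Banach lattice $E_{\mathbb{R}}$, called the real part of $E$. The order on $E$ is that of its real part, $E_+$ denotes the positive cone, and suprema are taken in the real part of $E$. A linear operator on $E$ is positive if it maps $E_+$ into $E_+$. A $C_0$-semigroup $(T_t)_{t\in[0,\infty)}$ on $E$ is positive and contractive if, for each $t \in [0,\infty)$, the operator $T_t$ is positive and satisfies $\|T_t\| \le 1$. Fatou property: $E$ has the Fatou property if every increasing net $(x_j)_{j\in J} \subseteq E_+$ which possesses a supremum $x \in E$ satisfies $\|x\| = \sup_{j \in J} \|x_j\|$. Monotonically complete: $E$ is monotonically complete if every norm bounded increasing net in $E_+$ has a supremum in $E$ (equivalently, every norm bounded increasing net in the real part of $E$ has a supremum). *)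

(* Defs.v *)
From HB Require Import structures.
From mathcomp Require Import all_boot all_order all_algebra.
From mathcomp Require Import ring lra.
From mathcomp Require Import complex.
From mathcomp Require Import all_classical all_reals topology normedtype.
From mathcomp Require Import sequences derive realfun trigo.

Set Implicit Arguments.
Unset Strict Implicit.
Unset Printing Implicit Defensive.

Import Order.TTheory GRing.Theory Num.Theory.
Import numFieldNormedType.Exports.

Local Open Scope classical_set_scope.
Local Open Scope ring_scope.
Local Open Scope complex_scope.

(* The order is part of the mixin because HB does not allow a join of
   [CompleteNormedModule] and [Order.Lattice] to be added at this point;
   the [latticeType] structure is recovered just below. *)
HB.mixin Record NormedModule_isBanachLattice (R : realType) (E : Type)
    of CompleteNormedModule R E := {
  bl_le : rel E ;
  bl_meet : E -> E -> E ;
  bl_join : E -> E -> E ;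
  bl_le_refl : reflexive bl_le ;
  bl_le_anti : antisymmetric bl_le ;
  bl_le_trans : transitive bl_le ;
  bl_lexI : forall x y z, bl_le x (bl_meet y z) = bl_le x y && bl_le x z ;
  bl_leUx : forall x y z, bl_le (bl_join x y) z = bl_le x z && bl_le y z ;
  bl_leD2l : forall z x y, bl_le x y -> bl_le (z + x) (z + y) ;
  bl_scale_ge0 : forall (a : R) x, 0 <= a -> bl_le 0 x -> bl_le 0 (a *: x) ;
  bl_norm_solid : forall x y,
    bl_le (bl_join x (- x)) (bl_join y (- y)) -> `|x| <= `|y|
}.

#[short(type="banachLatticeType")]
HB.structure Definition BanachLattice (R : realType) :=
  { E of CompleteNormedModule R E & NormedModule_isBanachLattice R E }.

Section BanachLatticeOrder.
Context (R : realType) (E : banachLatticeType R).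

HB.instance Definition _ := Order.Le_isPOrder.Build ring_display E
  bl_le_refl bl_le_anti bl_le_trans.
HB.instance Definition _ :=
  Order.POrder_isMeetSemilattice.Build ring_display E bl_lexI.
HB.instance Definition _ :=
  Order.POrder_isJoinSemilattice.Build ring_display E bl_leUx.

Lemma bl_lerD2l (z x y : E) : x <= y -> z + x <= z + y.
Proof. exact: bl_leD2l. Qed.

Lemma bl_scaler_ge0 (a : R) (x : E) : 0 <= a -> 0 <= x -> 0 <= a *: x.
Proof. exact: bl_scale_ge0. Qed.

Lemma bl_normS (x y : E) :
  Order.join x (- x) <= Order.join y (- y) -> `|x| <= `|y|.
Proof. exact: bl_norm_solid. Qed.

End BanachLatticeOrder.

Section Modulus.
Context (R : realType) (E : banachLatticeType R).
Implicit Types (x y z u : E) (a b p q : R).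

Definition vabs x : E := Order.join x (- x).

Definition rotations x y : set E :=
  [set cos t *: x + sin t *: y | t in [set: R]].

(* [cmodulus x y] is |x + iy| = sup_t (cos t x + sin t y); this supremum always
   exists in a Banach lattice, see [cmodulus_isLub]. *)
Definition cmodulus x y : E := supremum 0 (rotations x y).

Lemma bl_le_sub x y : (x <= y) = (0 <= y - x).
Proof.
apply/idP/idP => [h|h].
  by have := bl_lerD2l (- x) h; rewrite addNr addrC.
by have := bl_lerD2l x h; rewrite addr0 addrC subrK.
Qed.

Lemma bl_addr_ge0 x y : 0 <= x -> 0 <= y -> 0 <= x + y.
Proof. by move=> x0 y0; apply: (le_trans x0); have := bl_lerD2l x y0; rewrite addr0. Qed.

Lemma bl_lerD x y z u : x <= y -> z <= u -> x + z <= y + u.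
Proof.
rewrite (bl_le_sub x) (bl_le_sub z) (bl_le_sub (x + z)) => h1 h2.
by rewrite opprD addrACA bl_addr_ge0.
Qed.

Lemma bl_lerN2 x y : x <= y -> - y <= - x.
Proof. by rewrite bl_le_sub (bl_le_sub (- y)) opprK addrC. Qed.

Lemma bl_ler_scale a x y : 0 <= a -> x <= y -> a *: x <= a *: y.
Proof. by move=> a0; rewrite bl_le_sub (bl_le_sub (a *: x)) -scalerBr; apply: bl_scaler_ge0. Qed.

Lemma vabs_ler x : x <= vabs x. Proof. exact: leUl. Qed.
Lemma vabs_lerN x : - x <= vabs x. Proof. exact: leUr. Qed.

Lemma vabs_le x u : x <= u -> - x <= u -> vabs x <= u.
Proof. by move=> h1 h2; rewrite /vabs leUx h1 h2. Qed.

Lemma vabs_ge0 x : 0 <= vabs x.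
Proof.
have h := bl_lerD (vabs_ler x) (vabs_lerN x); rewrite subrr in h.
have -> : vabs x = 2^-1 *: (vabs x + vabs x).
  by rewrite -[in RHS](scale1r (vabs x)) -scalerDl scalerA mulVf ?scale1r// pnatr_eq0.
by apply: bl_scaler_ge0 => //; rewrite invr_ge0.
Qed.

Lemma vabs_id x : 0 <= x -> vabs x = x.
Proof.
move=> x0; apply/eqP; rewrite eq_le vabs_ler andbT vabs_le//.
by apply: (le_trans _ x0); have := bl_lerN2 x0; rewrite oppr0.
Qed.

Lemma bl_norm_vabs x : `|vabs x| = `|x|.
Proof.
by apply/le_anti/andP; split; apply: bl_normS;
  rewrite -/(vabs _) -/(vabs _) (vabs_id (vabs_ge0 x)).
Qed.

Lemma bl_norm_le x y : 0 <= x -> x <= y -> `|x| <= `|y|.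
Proof.
move=> x0 xy; apply: bl_normS.
by rewrite -/(vabs _) -/(vabs _) !vabs_id// (le_trans x0).
Qed.

Lemma vabs_norm_le x u : x <= u -> - x <= u -> `|x| <= `|u|.
Proof. by move=> h1 h2; rewrite -bl_norm_vabs; apply: bl_norm_le (vabs_ge0 _) (vabs_le h1 h2). Qed.

Lemma vabs_scale_le a x : a *: x <= `|a| *: vabs x.
Proof.
have [a0|a0] := leP 0 a; first by rewrite ger0_norm// bl_ler_scale// vabs_ler.
rewrite ltr0_norm//; have -> : a *: x = (- a) *: (- x) by rewrite scalerN scaleNr opprK.
by apply: bl_ler_scale; [rewrite oppr_ge0 ltW|exact: vabs_lerN].
Qed.

(* The positive cone is closed. *)
Lemma bl_ge0_approx x :
  (forall e : R, 0 < e -> exists2 y, 0 <= y & `|y - x| <= e) -> 0 <= x.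
Proof.
move=> h; set n := Order.join (- x) 0.
have n0 : 0 <= n by apply: leUr.
suff n_eq0 : n = 0.
  have : - x <= 0 by rewrite -n_eq0; apply: leUl.
  by move=> /bl_lerN2; rewrite oppr0 opprK.
apply/normr0_eq0/le_anti; rewrite normr_ge0 andbT.
apply/ler_addgt0Pr => e e0; rewrite add0r.
have [y y0 yx] := h e e0; apply: le_trans yx; rewrite -(bl_norm_vabs (y - x)).
apply: bl_norm_le => //; rewrite /n leUx vabs_ge0 andbT.
apply: le_trans (vabs_ler _).
by have := bl_lerD y0 (lexx (- x)); rewrite add0r.
Qed.

Lemma bl_le_approx x y :
  (forall e : R, 0 < e -> exists2 z, `|z - y| <= e & x <= z) -> x <= y.
Proof.
move=> h; rewrite bl_le_sub; apply: bl_ge0_approx => e /h[z zy xz].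
by exists (z - x); [rewrite -bl_le_sub|rewrite opprB addrA subrK].
Qed.

Lemma bl_ge_approx x y :
  (forall e : R, 0 < e -> exists2 z, `|z - x| <= e & z <= y) -> x <= y.
Proof.
move=> h; rewrite bl_le_sub; apply: bl_ge0_approx => e /h[z zy xz].
exists (y - z); first by rewrite -bl_le_sub.
by rewrite opprB addrC addrA subrK -normrN opprB.
Qed.

Lemma cos_sin_polar p q : exists t : R, [/\ - 4 <= t, t <= 4,
  p = Num.sqrt (p ^+ 2 + q ^+ 2) * cos t & q = Num.sqrt (p ^+ 2 + q ^+ 2) * sin t].
Proof.
set r := Num.sqrt _.
have r2 : r ^+ 2 = p ^+ 2 + q ^+ 2 by rewrite sqr_sqrtr// addr_ge0// sqr_ge0.
have [r0|r0] := eqVneq r 0.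
  exists 0; rewrite r0 !mul0r; split; try lra.
  - by move: r2; rewrite r0; nra.
  - by move: r2; rewrite r0; nra.
have rp : 0 < r by rewrite lt_neqAle eq_sym r0 sqrtr_ge0.
have pi4 : pi <= 4 :> R by have := pihalf_lt2 R; lra.
have pr : -1 <= p / r <= 1.
  by rewrite ler_pdivlMr// ler_pdivrMr// mulN1r mul1r; apply/andP; split; nra.
have h0 := acos_ge0 pr; have h1 := acos_lepi pr.
have hc : cos (acos (p / r)) = p / r by rewrite acosK// in_itv.
have hs : r * sin (acos (p / r)) = `|q|.
  rewrite sin_acos// -[r in LHS]gtr0_norm// -sqrtr_sqr -sqrtrM ?sqr_ge0//.
  rewrite -[RHS]sqrtr_sqr; congr Num.sqrt.
  by rewrite sqrtr_sqr gtr0_norm// mulrBr mulr1 expr_div_n mulrC divfK ?expf_neq0// r2 addrC addKr.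
have [q0|q0] := leP 0 q.
  exists (acos (p / r)); split; try lra.
    by rewrite hc mulrC divfK.
  by rewrite hs ger0_norm.
exists (- acos (p / r)); split; try lra.
  by rewrite cosN hc mulrC divfK.
by rewrite sinN mulrN hs ltr0_norm// opprK.
Qed.

Lemma cos_lip (a b : R) : `|cos a - cos b| <= `|a - b|.
Proof.
wlog ba : a b / b <= a.
  move=> H; have [/H//|/ltW/H] := leP b a.
  by rewrite distrC (distrC b).
have [|c _ ->] := @MVT_segment R (@cos R) (fun c : R => - sin c) b a ba.
  by apply: continuous_subspaceT => c; apply: continuous_cos.
rewrite normrM normrN ler_piMl// ler_norml sin_le1 andbT.
by have := sin_geN1 c.
Qed.

Lemma sin_lip (a b : R) : `|sin a - sin b| <= `|a - b|.
Proof.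
wlog ba : a b / b <= a.
  move=> H; have [/H//|/ltW/H] := leP b a.
  by rewrite distrC (distrC b).
have [|c _ ->] := @MVT_segment R (@sin R) (fun c : R => cos c) b a ba.
  by apply: continuous_subspaceT => c; apply: continuous_sin.
rewrite normrM ler_piMl// ler_norml cos_le1 andbT.
by have := cos_geN1 c.
Qed.

Local Notation rot x y t := (cos t *: x + sin t *: y).

Lemma rot_lip x y (a b : R) :
  rot x y a <= rot x y b + `|a - b| *: (vabs x + vabs y).
Proof.
rewrite bl_le_sub.
have -> : rot x y b + `|a - b| *: (vabs x + vabs y) - rot x y a =
    (`|a - b| *: vabs x - (cos a - cos b) *: x) +
    (`|a - b| *: vabs y - (sin a - sin b) *: y).
  rewrite !scalerBl scalerDr !opprB opprD (addrACA (cos b *: x)) [LHS]addrACA.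
  by congr (_ + _); rewrite addrA; congr (_ + _); exact: addrC.
apply: bl_addr_ge0; rewrite -bl_le_sub; apply: le_trans (vabs_scale_le _ _) _;
  rewrite bl_le_sub -scalerBl; apply: bl_scaler_ge0; rewrite ?vabs_ge0//.
  by rewrite subr_ge0 cos_lip.
by rewrite subr_ge0 sin_lip.
Qed.

Fixpoint joinn (f : nat -> E) (m : nat) : E :=
  if m is k.+1 then Order.join (joinn f k) (f m) else f 0%N.

Lemma joinn_ub f m k : (k <= m)%N -> f k <= joinn f m.
Proof.
elim: m => [|m IH]; first by rewrite leqn0 => /eqP ->.
rewrite leq_eqVlt => /orP[/eqP ->|/IH h]; first exact: leUr.
by apply: (le_trans h); exact: leUl.
Qed.

Lemma joinn_le f m u : (forall k, f k <= u) -> joinn f m <= u.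
Proof. by move=> h; elim: m => [|m IH] //=; rewrite leUx IH h. Qed.

(* Joins over finer and finer grids form a Cauchy sequence, whose limit is the
   supremum. *)
Lemma rotations_has_lub x y : exists s, isLub (rotations x y) s.
Proof.
pose u := vabs x + vabs y.
have u0 : 0 <= u by apply: bl_addr_ge0; exact: vabs_ge0.
pose d (n : nat) : R := n.+1%:R^-1.
have d0 n : 0 < d n by rewrite invr_gt0.
pose g n k := rot x y (k%:R * d n - 4).
pose s n := joinn (g n) (8 * n.+1).
have g_le n t : rot x y t <= s n + d n *: u.
  have [t' [t1 t2 hc hs]] := cos_sin_polar (cos t) (sin t).
  rewrite cos2Dsin2 sqrtr1 !mul1r in hc hs; rewrite hc hs.
  pose k := Num.truncn ((t' + 4) * n.+1%:R).
  have t40 : 0 <= (t' + 4) * n.+1%:R by rewrite mulr_ge0//; lra.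
  have /andP[k1 k2] := truncn_itv t40; rewrite -/k in k1 k2.
  have kn : (k <= 8 * n.+1)%N.
    rewrite -(ler_nat R) (le_trans k1)// natrM ler_pM2r ?ltr0n//; lra.
  apply: (le_trans (rot_lip _ _ t' (k%:R * d n - 4))).
  apply: bl_lerD; first exact: (joinn_ub (g n) kn).
  rewrite bl_le_sub -scalerBl; apply: bl_scaler_ge0 => //; rewrite subr_ge0.
  have -> : t' - (k%:R * d n - 4) = ((t' + 4) * n.+1%:R - k%:R) * d n.
    by rewrite mulrBl mulfK ?pnatr_eq0//; ring.
  rewrite ger0_norm; first by rewrite ler_piMl ?ltW//; move: k2; rewrite -natr1; lra.
  by rewrite mulr_ge0 ?subr_ge0// ltW.
have s_le n v : (forall t, rot x y t <= v) -> s n <= v by move=> h; apply: joinn_le => k; apply: h.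
have s_cauchy n m : `|s n - s m| <= (d n + d m) * `|u|.
  have dd : 0 <= d n + d m by rewrite addr_ge0// ltW.
  rewrite -[X in X * _](ger0_norm dd) -normrZ.
  have step i j : s i - s j <= (d i + d j) *: u.
    have h : s i <= s j + d j *: u by apply: s_le => t; exact: g_le.
    have := bl_lerD2l (- s j) h; rewrite addKr addrC => /le_trans; apply.
    rewrite bl_le_sub -scalerBl; apply: bl_scaler_ge0 => //.
    by rewrite addrK ltW.
  apply: vabs_norm_le; first exact: step.
  by rewrite opprB (addrC (d n)); exact: step.
have dc : d @ \oo --> (0 : R).
  exact: cvg_harmonic.
have small e : 0 < e -> \forall n \near \oo, d n * (`|u| + 1) < e.
  move=> e0.
  have u1 : 0 < `|u| + 1 by rewrite ltr_pwDr.
  have e1 : 0 < e / (`|u| + 1) by rewrite divr_gt0.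
  move/cvgrPdist_lt : dc => /(_ _ e1); apply: filterS => n.
  by rewrite sub0r normrN gtr0_norm// ltr_pdivlMr.
have sc : cvg (s @ \oo).
  apply/cauchy_cvgP/cauchy_exP => e e0.
  have e2 : 0 < e / 2 by rewrite divr_gt0.
  have [N _ hN] := small _ e2.
  exists (s N), N => // n Nn /=.
  rewrite -ball_normE /=; apply: le_lt_trans (s_cauchy _ _) _.
  have := hN N (leqnn N); have := hN n Nn; have := normr_ge0 u.
  have := d0 n; have := d0 N => /=.
  by rewrite !mulrDr !mulrDl !mulr1 => *; lra.
have happrox e : 0 < e -> exists n, `|s n - lim (s @ \oo)| <= e /\ d n * (`|u| + 1) < e.
  move=> e0; have h1 := small _ e0.
  have /cvgrPdist_le/(_ _ e0) h2 := sc.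
  have [n [h3 h4]] := @filter_ex _ _ _ _ (filterI h1 h2).
  by exists n; split => //; rewrite distrC.
exists (lim (s @ \oo)); split.
  move=> _ [t _ <-]; apply: bl_le_approx => e e0.
  have e2 : 0 < e / 2 by rewrite divr_gt0.
  have [n [h1 h2]] := happrox _ e2.
  exists (s n + d n *: u); last exact: g_le.
  rewrite addrAC; apply: le_trans (ler_normD _ _) _.
  rewrite normrZ gtr0_norm// (splitr e) lerD//.
  by apply: le_trans (ltW h2); rewrite ler_pM2l// lerDl.
move=> b hb; apply: bl_ge_approx => e e0.
have [n [h1 _]] := happrox _ e0.
by exists (s n) => //; apply: s_le => t; apply: hb; exists t.
Qed.

Lemma cmodulus_isLub x y : isLub (rotations x y) (cmodulus x y).
Proof.
have [s hs] := rotations_has_lub x y.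
suff -> : cmodulus x y = s by [].
rewrite /cmodulus /supremum; case: ifPn => [/eqP r0|_].
  have : rotations x y (rot x y 0) by exists 0.
  by rewrite r0.
have ss : supremums (rotations x y) s by case: hs.
by apply: (is_subset1_supremums _ ss); apply: (@xgetPex _ 0); exists s.
Qed.

Lemma cmodulus_ub p q x y :
  p *: x + q *: y <= Num.sqrt (p ^+ 2 + q ^+ 2) *: cmodulus x y.
Proof.
have [t [_ _]] := cos_sin_polar p q; set r := Num.sqrt _ => hp hq.
rewrite {1}hp {1}hq.
rewrite -!scalerA -scalerDr; apply: bl_ler_scale; first exact: sqrtr_ge0.
by apply: (cmodulus_isLub x y).1; exists t.
Qed.

Lemma cmodulus_le x y u : (forall t, rot x y t <= u) -> cmodulus x y <= u.
Proof. by move=> h; apply: (cmodulus_isLub x y).2 => _ [t _ <-]. Qed.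

Lemma cmodulus_ge0 x y : 0 <= cmodulus x y.
Proof.
have := cmodulus_ub 0 0 x y; have := cmodulus_ub 1 0 x y.
have := cmodulus_ub (-1) 0 x y.
rewrite sqrrN expr1n expr0n addr0 sqrtr1 !scale0r !addr0 scaleN1r !scale1r.
move=> h1 h2 _; apply: le_trans (vabs_ge0 x) _; exact: vabs_le.
Qed.

Lemma cmodulus_real x : cmodulus x 0 = vabs x.
Proof.
apply/le_anti/andP; split.
  apply: cmodulus_le => t; rewrite scaler0 addr0.
  apply: (le_trans (vabs_scale_le _ _)).
  rewrite bl_le_sub -[X in X - _]scale1r -scalerBl bl_scaler_ge0 ?vabs_ge0//.
  by rewrite subr_ge0 ler_norml cos_geN1 cos_le1.
have := cmodulus_ub 1 0 x 0; have := cmodulus_ub (-1) 0 x 0.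
rewrite sqrrN expr1n expr0n addr0 sqrtr1 scaler0 !addr0 scaleN1r !scale1r.
by move=> h1 h2; exact: vabs_le.
Qed.

End Modulus.

(* The complexification E + iE, where [(x, y)] stands for [x + iy]. *)
Definition complexification (R : realType) (E : banachLatticeType R) : Type :=
  (E * E)%type.

Section Complexification.
Context (R : realType) (E : banachLatticeType R).
Local Notation EC := (complexification E).

HB.instance Definition _ := GRing.Zmodule.copy EC (E * E)%type.

Definition cscale (l : R[i]) (z : EC) : EC :=
  let: a +i* b := l in (a *: z.1 - b *: z.2, a *: z.2 + b *: z.1).

Fact cscaleA (a b : R[i]) (z : EC) : cscale a (cscale b z) = cscale (a * b) z.
Proof.
case: a b z => [a a'] [b b'] [x y]; rewrite /cscale /=; congr pair.
  rewrite !scalerBr !scalerDr !scalerBl !scalerDl !scalerA !opprD.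
  by rewrite (addrC (- (_ *: y))) [LHS]addrACA.
rewrite !scalerBr !scalerDr !scalerBl !scalerDl !scalerA.
by rewrite (addrC ((a' * b) *: x)) [LHS]addrACA.
Qed.

Fact cscale1 : left_id (1 : R[i]) cscale.
Proof. by case=> x y; rewrite /cscale /= !scale1r !scale0r subr0 addr0. Qed.

Fact cscaleDr : right_distributive cscale +%R.
Proof.
move=> [a b] [x y] [x' y']; rewrite /cscale /=; congr pair.
  by rewrite !scalerDr opprD addrACA.
by rewrite !scalerDr addrACA.
Qed.

Fact cscaleDl (z : EC) : {morph cscale^~ z : a b / a + b}.
Proof.
case: z => x y [a a'] [b b']; rewrite /cscale /=; congr pair.
  by rewrite !scalerDl opprD addrACA.
by rewrite !scalerDl addrACA.
Qed.

HB.instance Definition _ := GRing.Zmodule_isLmodule.Build R[i] EC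
  cscaleA cscale1 cscaleDr cscaleDl.

(* The norm of a normed module over [R[i]] is [R[i]]-valued. *)
Definition cnorm (z : EC) : R[i] := (`|cmodulus z.1 z.2|)%:C.

Fact cnormD (z w : EC) : cnorm (z + w) <= cnorm z + cnorm w.
Proof.
rewrite /cnorm -rmorphD /= lecR.
apply: le_trans (ler_normD _ _); apply: bl_norm_le; first exact: cmodulus_ge0.
apply: cmodulus_le => t; rewrite !scalerDr addrACA.
by apply: bl_lerD; apply: (cmodulus_isLub _ _).1; exists t.
Qed.

Let cnorm_scale_le (l : R[i]) (z : EC) : cnorm (l *: z) <= `|l| * cnorm z.
Proof.
case: l z => [a b] [x y]; rewrite /cnorm normc_def -rmorphM /= lecR.
rewrite -[X in X * _](ger0_norm (sqrtr_ge0 _)) -normrZ.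
apply: bl_norm_le; first exact: cmodulus_ge0.
apply: cmodulus_le => t.
have -> : cos t *: (a *: x - b *: y) + sin t *: (a *: y + b *: x) =
    (a * cos t + b * sin t) *: x + (a * sin t - b * cos t) *: y.
  rewrite scalerBr scalerDr scalerDl scalerBl !scalerA.
  rewrite ![_ * cos t]mulrC ![_ * sin t]mulrC.
  by rewrite (addrC ((sin t * a) *: y)) addrACA (addrC (- _)).
apply: le_trans (cmodulus_ub _ _ _ _) _.
suff -> : (a * cos t + b * sin t) ^+ 2 + (a * sin t - b * cos t) ^+ 2 =
  a ^+ 2 + b ^+ 2 by [].
have h := cos2Dsin2 t; transitivity ((a ^+ 2 + b ^+ 2) * (cos t ^+ 2 + sin t ^+ 2)).
  by ring.
by rewrite h mulr1.
Qed.

Fact cnormZ (l : R[i]) (z : EC) : cnorm (l *: z) = `|l| * cnorm z.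
Proof.
apply/le_anti; rewrite cnorm_scale_le andTb.
have [->|l0] := eqVneq l 0.
  by rewrite normr0 mul0r /cnorm lecR.
have := cnorm_scale_le l^-1 (l *: z).
by rewrite scalerA mulVf// scale1r normfV ler_pdivlMl ?normr_gt0.
Qed.

Fact cnorm0_eq0 (z : EC) : cnorm z = 0 -> z = 0.
Proof.
case: z => x y; rewrite /cnorm /= => /complexI/normr0_eq0 z0.
have h p q : p *: x + q *: y <= 0 by have := cmodulus_ub p q x y; rewrite z0 scaler0.
have h0 u : u <= 0 -> - u <= 0 -> u = 0 :> E.
  by move=> u1 u2; apply/le_anti; rewrite u1 -[X in _ <= X]opprK -oppr0 bl_lerN2.
congr pair; apply: h0.
- by have := h 1 0; rewrite scale1r scale0r addr0.
- by have := h (-1) 0; rewrite scaleN1r scale0r addr0.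
- by have := h 0 1; rewrite scale1r scale0r add0r.
- by have := h 0 (-1); rewrite scaleN1r scale0r add0r.
Qed.

HB.instance Definition _ := Lmodule_isNormed.Build R[i] EC
  cnormD cnormZ cnorm0_eq0.

Lemma cnormE (z : EC) : `|z| = (`|cmodulus z.1 z.2|)%:C.
Proof. by []. Qed.

(* The embedding of [E] into its complexification is isometric. *)
Lemma cnorm_real (x : E) : `|(x, 0) : EC| = `|x|%:C.
Proof. by rewrite cnormE cmodulus_real bl_norm_vabs. Qed.

Definition positive_cone : set EC := [set z | 0 <= z.1 /\ z.2 = 0].

Definition positive_operator (T : EC -> EC) : Prop :=
  forall z, positive_cone z -> positive_cone (T z).

End Complexification.

Section Nets.
Context (R : realType) (E : banachLatticeType R).

Definition directed (J : Type) (leJ : J -> J -> Prop) : Prop :=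
  [/\ inhabited J, forall i, leJ i i,
      forall i j k, leJ i j -> leJ j k -> leJ i k &
      forall i j, exists2 k, leJ i k & leJ j k].

Definition increasing_net (J : Type) (leJ : J -> J -> Prop) (x : J -> E) : Prop :=
  forall i j, leJ i j -> x i <= x j.

Definition fatou_property : Prop :=
  forall (J : Type) (leJ : J -> J -> Prop) (x : J -> E) (s : E),
    directed leJ -> increasing_net leJ x -> (forall j, 0 <= x j) ->
    isLub (range x) s -> `|s| = sup (range (fun j => `|x j|)).

Definition monotonically_complete : Prop :=
  forall (J : Type) (leJ : J -> J -> Prop) (x : J -> E),
    directed leJ -> increasing_net leJ x -> (forall j, 0 <= x j) ->
    (exists M : R, forall j, `|x j| <= M) ->
    exists s : E, isLub (range x) s.

End Nets.

Section Semigroups.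
Context (R : realType) (X : normedModType R[i]).

(* Operator norm of a bounded operator; it is meaningless for unbounded ones,
   for which the real supremum is not that of a bounded set. *)
Definition opnorm (T : X -> X) : R :=
  sup [set complex.Re `|T x| | x in [set x : X | `|x| <= 1]].

(* The values of [T] at negative times are irrelevant. *)
Definition C0_semigroup (T : R -> {linear X -> X}) : Prop :=
  [/\ forall t, 0 <= t -> continuous (T t),
      forall x, T 0 x = x,
      forall s t, 0 <= s -> 0 <= t -> forall x, T (s + t) x = T s (T t x) &
      forall x, T t x @[t --> 0^'+] --> x].

(* The generator as an unbounded operator, given by its graph: [(x, y)] belongs
   to it when [x] is in the domain and [y] is its image. *)
Definition generator (T : R -> {linear X -> X}) : set (X * X) :=
  [set xy | (t^-1)%:C *: (T t xy.1 - xy.1) @[t --> 0^'+] --> xy.2].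

Definition is_eigenvalue (A : set (X * X)) (l : R[i]) : Prop :=
  exists2 x : X, x != 0 & A (x, l *: x).

End Semigroups.

(* Main.v *)
Require Import Defs.
From mathcomp Require Import all_boot all_order all_algebra.
From mathcomp Require Import ring lra.
From mathcomp Require Import complex.
From mathcomp Require Import all_classical all_reals topology normedtype.
From mathcomp Require Import sequences derive realfun trigo.

(* Let z = x + iy be an eigenvector, so that T_t z = e^{i beta t} z.  In the
   functional calculus of E put w_0 = |z| and g_0 = eps |z| (sgn z)^k.  For small
   eps the function r (1 + eps cos (k theta + s)) is sublinear on the plane for
   every s, hence w_0 + Re (e^{is} g_0) is a supremum of real linear combinations
   of x and y, and positivity of T_t gives
     w_0 + Re (e^{is} e^{ik beta t} g_0) <= T_t (w_0 + Re (e^{is} g_0)).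
   Monotone completeness and the Fatou property allow Zorn's lemma on the pairs
   (w, g) above (w_0, g_0) with this property and |w| <= |w_0| in norm.  The
   twisted semigroup (T_t, e^{-ik beta t} T_t) maps a maximal pair to a larger
   one, so it fixes it: T_t g = e^{ik beta t} g.  If g were 0 then w >= w_0 + |g_0|
   = (1 + eps) |z|, contradicting the norm bound. *)

Set Implicit Arguments.
Unset Strict Implicit.
Unset Printing Implicit Defensive.

Import Order.TTheory GRing.Theory Num.Theory.
Import numFieldNormedType.Exports.

Local Open Scope ring_scope.
Local Open Scope complex_scope.

(** * Identities between linear combinations *)

Section LinearCombinations.
Context {R : comNzRingType} {V : lmodType R}.

Inductive lexpr : Type :=
| LVar of nat
| LZero
| LAdd of lexpr & lexpr
| LOpp of lexpr
| LScale of R & lexpr.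

Fixpoint leval (env : seq V) (e : lexpr) : V :=
  match e with
  | LVar n => env`_n
  | LZero => 0
  | LAdd e1 e2 => leval env e1 + leval env e2
  | LOpp e1 => - leval env e1
  | LScale a e1 => a *: leval env e1
  end.

Fixpoint lcoef (e : lexpr) (n : nat) : R :=
  match e with
  | LVar m => if m == n then 1 else 0
  | LZero => 0
  | LAdd e1 e2 => lcoef e1 n + lcoef e2 n
  | LOpp e1 => - lcoef e1 n
  | LScale a e1 => a * lcoef e1 n
  end.

Lemma leval_coef (env : seq V) (e : lexpr) :
  leval env e = \sum_(i < size env) lcoef e i *: env`_i.
Proof.
elim: e => [m||e1 IH1 e2 IH2|e1 IH1|a e1 IH1] /=.
- have [ms|ms] := ltnP m (size env).
    rewrite (bigD1 (Ordinal ms))//= eqxx scale1r big1 ?addr0// => i im.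
    by case: eqVneq => [mi|_]; rewrite ?scale0r//; move/eqP: im; case; exact: val_inj.
  rewrite nth_default// big1// => i _; case: eqVneq => [mi|]; rewrite ?scale0r//.
  by move: ms; rewrite mi leqNgt ltn_ord.
- by rewrite big1// => i _; rewrite scale0r.
- by rewrite IH1 IH2 -big_split; apply: eq_bigr => i _; rewrite scalerDl.
- by rewrite IH1 -sumrN; apply: eq_bigr => i _; rewrite scaleNr.
- by rewrite IH1 scaler_sumr; apply: eq_bigr => i _; rewrite scalerA.
Qed.

(** A conjunction that unfolds by computation into one scalar equation per atom, each of which can
    be passed to [ring]. *)
Fixpoint allcoef (n : nat) (e1 e2 : lexpr) : Prop :=
  if n is m.+1 then lcoef e1 m = lcoef e2 m /\ allcoef m e1 e2 else True.

Lemma leval_eq (env : seq V) (e1 e2 : lexpr) :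
  allcoef (size env) e1 e2 -> leval env e1 = leval env e2.
Proof.
move=> h; rewrite !leval_coef; apply: eq_bigr => i _; congr (_ *: _).
suff H n j : allcoef n e1 e2 -> (j < n)%N -> lcoef e1 j = lcoef e2 j by exact: H h _.
elim: n => //= n IH [h1 h2]; rewrite ltnS leq_eqVlt => /orP[/eqP ->//|].
exact: IH.
Qed.

End LinearCombinations.

Ltac lmod_index v env :=
  lazymatch env with
  | v :: _ => constr:(O)
  | _ :: ?env' => let n := lmod_index v env' in constr:(S n)
  end.

Ltac lmod_mem v env :=
  match env with
  | v :: _ => constr:(true)
  | _ :: ?env' => lmod_mem v env'
  | _ => constr:(false)
  end.

Ltac lmod_env t env :=
  lazymatch t with
  | ?a + ?b => let env' := lmod_env a env in lmod_env b env'
  | - ?a => lmod_env a env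
  | _ *: ?a => lmod_env a env
  | 0 => env
  | _ => match lmod_mem t env with
         | true => env
         | false => constr:(t :: env)
         end
  end.

Ltac lmod_reify R t env :=
  lazymatch t with
  | ?a + ?b => let a' := lmod_reify R a env in let b' := lmod_reify R b env in
               constr:(@LAdd R a' b')
  | - ?a => let a' := lmod_reify R a env in constr:(@LOpp R a')
  | ?c *: ?a => let a' := lmod_reify R a env in constr:(@LScale R c a')
  | 0 => constr:(@LZero R)
  | _ => let n := lmod_index t env in constr:(@LVar R n)
  end.

(* Proves an identity between linear combinations by comparing coefficients;
   the equations between coefficients that [ring] does not prove are left. *)
Ltac lmod R V :=
  lazymatch goal with
  | |- ?a = ?b =>
    let env := lmod_env a constr:(@nil V) in
    let env := lmod_env b env in
    let a' := lmod_reify R a env in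
    let b' := lmod_reify R b env in
    refine (@leval_eq R V env a' b' _);
    cbn [allcoef lcoef size eqn]; rewrite /=; repeat split; try ring
  end.

(** * Trigonometric support functions *)

Section Trigonometry.
Context {R : realType}.
Implicit Types (t d p q r k : R).

Lemma sin_natmul_le (n : nat) d : `|sin (n%:R * d)| <= n%:R * `|sin d|.
Proof.
elim: n => [|n IH]; first by rewrite !mul0r sin0 normr0.
rewrite -natr1 mulrDl mul1r sinD mulrDl mul1r.
apply: le_trans (ler_normD _ _) _; rewrite !normrM lerD//.
  by apply: le_trans IH; rewrite ler_piMr// cos_max.
by rewrite ler_piMl// cos_max.
Qed.

Lemma sin_sqr_le d : sin d ^+ 2 <= 2 * (1 - cos d).
Proof. by have := cos2Dsin2 d; have := cos_le1 d; have := cos_geN1 d; nra. Qed.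

(** Induction with the addition formula: the cross term is at most n sin^2 d <= 2n(1 - cos d), and
    the coefficients n^2 + 1 + 2n add up to (n+1)^2. *)
Lemma cos_natmul_ge (n : nat) d : 1 - cos (n%:R * d) <= n%:R ^+ 2 * (1 - cos d).
Proof.
elim: n => [|n IH]; first by rewrite !mul0r cos0 subrr expr0n mul0r.
rewrite -natr1 mulrDl mul1r cosD.
have h1 : cos (n%:R * d) * (1 - cos d) <= 1 - cos d.
  by rewrite ler_piMl ?subr_ge0 ?cos_le1.
have h2 : sin (n%:R * d) * sin d <= n%:R * (2 * (1 - cos d)).
  apply: le_trans (ler_norm _) _; rewrite normrM.
  apply: le_trans (_ : n%:R * `|sin d| * `|sin d| <= _).
    by rewrite ler_wpM2r// sin_natmul_le.
  by rewrite -mulrA -expr2 real_normK ?num_real// ler_wpM2l// sin_sqr_le.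
have -> : (n%:R + 1) ^+ 2 * (1 - cos d) =
  n%:R ^+ 2 * (1 - cos d) + (1 - cos d) + n%:R * (2 * (1 - cos d)) :> R by ring.
by move: IH; lra.
Qed.

(** The step from n to n + 1 adds an error of at most (1 + n^2)(1 - cos d), and n^3 + n^2 + 1 <=
    (n+1)^3. *)
Lemma sin_natmul_sub (n : nat) d :
  `|sin (n%:R * d) - n%:R * sin d| <= n%:R ^+ 3 * (1 - cos d).
Proof.
elim: n => [|n IH]; first by rewrite !mul0r sin0 subrr normr0 expr0n mul0r.
have u0 : 0 <= 1 - cos d by rewrite subr_ge0 cos_le1.
have n0 : 0 <= n%:R :> R by [].
have h1 : `|sin (n%:R * d) * (1 - cos d)| <= 1 - cos d.
  by rewrite normrM (ger0_norm u0) ler_piMl// sin_max.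
have h2 : `|(1 - cos (n%:R * d)) * sin d| <= n%:R ^+ 2 * (1 - cos d).
  rewrite normrM ger0_norm ?subr_ge0 ?cos_le1//.
  apply: le_trans (cos_natmul_ge n d).
  by rewrite ler_piMr ?sin_max// subr_ge0 cos_le1.
rewrite -natr1 mulrDl mul1r sinD.
have -> : sin (n%:R * d) * cos d + cos (n%:R * d) * sin d - (n%:R + 1) * sin d =
  (sin (n%:R * d) - n%:R * sin d) + - (sin (n%:R * d) * (1 - cos d)) +
  - ((1 - cos (n%:R * d)) * sin d) by ring.
apply: le_trans (ler_normD _ _) _; rewrite normrN.
apply: le_trans (lerD (ler_normD _ _) (lexx _)) _; rewrite normrN.
have h3 : (n%:R ^+ 3 + n%:R ^+ 2 + 1) * (1 - cos d) <= (n%:R + 1) ^+ 3 * (1 - cos d).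
  rewrite ler_wpM2r//.
  have -> : (n%:R + 1) ^+ 3 = n%:R ^+ 3 + n%:R ^+ 2 + 1 + (2 * n%:R ^+ 2 + 3 * n%:R) :> R.
    by ring.
  by rewrite lerDl addr_ge0// mulr_ge0// exprn_ge0.
by move: h3 IH h1 h2; rewrite !mulrDl mul1r; lra.
Qed.

(** Both differences vanish to second order where 1 - cos d does, so a small multiple of the k-th
    harmonic does not destroy the convexity of the unit disc. Negative k follows by parity. *)
Lemma trig_multiple_bound (k : int) : exists2 C : R, 1 <= C & forall d,
  `|cos (k%:~R * d) - cos d| <= C * (1 - cos d) /\
  `|sin (k%:~R * d) - k%:~R * sin d| <= C * (1 - cos d).
Proof.
pose n := `|k|%N.
have n0 : 0 <= n%:R :> R by [].
have nn : 0 <= n%:R ^+ 2 :> R by rewrite exprn_ge0.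
have nnn : 0 <= n%:R ^+ 3 :> R by rewrite exprn_ge0.
(* The cube serves the sine estimate; the square and the 1 serve the two signs of (1 - cos d) - (1 -
   cos (n d)). *)
exists (n%:R ^+ 3 + n%:R ^+ 2 + 1); first by lra.
have main d : `|cos (n%:R * d) - cos d| <= (n%:R ^+ 3 + n%:R ^+ 2 + 1) * (1 - cos d) /\
  `|sin (n%:R * d) - n%:R * sin d| <= (n%:R ^+ 3 + n%:R ^+ 2 + 1) * (1 - cos d).
  have u0 : 0 <= 1 - cos d by rewrite subr_ge0 cos_le1.
  have v0 : 0 <= 1 - cos (n%:R * d) by rewrite subr_ge0 cos_le1.
  have h3 := mulr_ge0 nnn u0; have h2 := mulr_ge0 nn u0.
  have := sin_natmul_sub n d; have := cos_natmul_ge n d.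
  rewrite !mulrDl mul1r => hc hs; split; last by apply: le_trans hs _; lra.
  by rewrite ler_norml; apply/andP; split; lra.
move=> d; have [k0|k0] := leP 0 k.
  by rewrite -(gez0_abs k0) pmulrn; exact: main.
rewrite -(opprK k) -(ltz0_abs k0) mulrNz !mulNr cosN sinN.
have [h1 h2] := main d; split => //.
by rewrite -opprD normrN.
Qed.

(* With k an integer and p large compared with |q| and |r|, this is the support
   function, in the direction of angle t, of a convex body in the plane. *)
Definition trig k p q r t : R := p + q * cos (k * t) + r * sin (k * t).

Definition dtrig k q r t : R := k * (r * cos (k * t) - q * sin (k * t)).

Lemma is_derive_trig k p q r t : is_derive t 1 (trig k p q r) (dtrig k q r t).
Proof.
rewrite /trig /dtrig.
by apply: is_derive_eq; rewrite /GRing.scale /=; ring.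
Qed.

Lemma continuous_trig k p q r : continuous (trig k p q r).
Proof.
move=> t; apply: differentiable_continuous; apply/derivable1_diffP.
exact: (@ex_derive _ _ _ _ _ _ _ (is_derive_trig k p q r t)).
Qed.

Lemma dtrigE k q r t : dtrig k q r t = trig k 0 (k * r) (- (k * q)) t.
Proof. by rewrite /dtrig /trig; ring. Qed.

Lemma continuous_dtrig k q r : continuous (dtrig k q r).
Proof.
have -> : dtrig k q r = trig k 0 (k * r) (- (k * q)).
  by apply/funext => t; exact: dtrigE.
exact: continuous_trig.
Qed.

(** The left side is the support, in direction [t + d], of the boundary point with normal [t]. The
    difference of the two sides is p(1 - cos d) + qA + rB with |A| and |B| at most 2C(1 - cos d). *)
Lemma trig_supporting (k : int) (C : R) p q r t d :
  (forall d, `|cos (k%:~R * d) - cos d| <= C * (1 - cos d) /\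
             `|sin (k%:~R * d) - k%:~R * sin d| <= C * (1 - cos d)) ->
  2 * C * (`|q| + `|r|) <= p ->
  trig k%:~R p q r t * cos d + dtrig k%:~R q r t * sin d <= trig k%:~R p q r (t + d).
Proof.
move=> /(_ d) [hc hs] pqr.
have u0 : 0 <= 1 - cos d by rewrite subr_ge0 cos_le1.
rewrite -subr_ge0 /trig /dtrig mulrDr cosD sinD.
set c := cos (_ * t); set s := sin (_ * t).
set c' := cos (_ * d) in hc *; set s' := sin (_ * d) in hs *.
set K := k%:~R in hs *.
have bound (a b : R) : `|a| <= 1 -> `|b| <= 1 ->
    `|a * (c' - cos d) + b * (s' - K * sin d)| <= 2 * C * (1 - cos d).
  move=> a1 b1; apply: le_trans (ler_normD _ _) _; rewrite !normrM.
  have := ler_pM (normr_ge0 a) (normr_ge0 (c' - cos d)) a1 hc.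
  have := ler_pM (normr_ge0 b) (normr_ge0 (s' - K * sin d)) b1 hs.
  lra.
have h1 := bound c (- s) (cos_max _); rewrite normrN in h1.
have {}h1 := h1 (sin_max _).
have h2 := bound s c (sin_max _) (cos_max _).
have h3 := ler_wpM2l (normr_ge0 q) h1; rewrite -normrM in h3.
have h4 := ler_wpM2l (normr_ge0 r) h2; rewrite -normrM in h4.
move: h3 h4; set A := c * _ + _; set B := s * _ + _ => h3 h4.
have h5 := ler_norm (- (q * A)); have h6 := ler_norm (- (r * B)).
rewrite !normrN in h5 h6.
have h7 := ler_wpM2r u0 pqr.
have -> : p + q * (c * c' - s * s') + r * (s * c' + c * s') -
   ((p + q * c + r * s) * cos d + K * (r * c - q * s) * sin d) =
   p * (1 - cos d) + q * A + r * B by rewrite /A /B; ring.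
move: h7; rewrite mulrDr !mulrDl => h7; lra.
Qed.

End Trigonometry.

(** * Convex curves with trigonometric support function, and the hull they span *)

Section SupportFunctional.
Context {R : realType} {E : banachLatticeType R}.
Implicit Types (x y u v w : E) (a b k p q r t : R).

Lemma bl_scale_cancel (c : R) x y : 0 < c -> c *: x <= c *: y -> x <= y.
Proof.
move=> c0 h; rewrite -[x]scale1r -[y]scale1r -(mulVf (lt0r_neq0 c0)) -!scalerA.
by apply: bl_ler_scale => //; rewrite invr_ge0 ltW.
Qed.

(** The nonnegative difference has a minimum at the contact angle, so its derivative vanishes
    there. *)
Lemma trig_contact k p q r a b t :
  (forall s, a * cos s + b * sin s <= trig k p q r s) ->
  a * cos t + b * sin t = trig k p q r t ->
  b * cos t - a * sin t = dtrig k q r t.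
Proof.
move=> h ht; pose D s := trig k p q r s - (a * cos s + b * sin s).
have dD (s : R) : is_derive s (1 : R) D (dtrig k q r s - (b * cos s - a * sin s)).
  have := is_derive_trig k p q r s => dh.
  by apply: is_derive_eq; rewrite /GRing.scale /=; ring.
have : is_derive t (1 : R) D 0.
  apply: (@derive1_at_min _ D (t - 1) (t + 1)).
  - by lra.
  - by move=> s _; exact: ex_derive.
  - by rewrite in_itv /=; apply/andP; split; lra.
  - by move=> s _; rewrite /D -ht subrr subr_ge0.
by move=> /(@derive_val _ _ _ _ _ _ _) e0; have := dD t;
   move=> /(@derive_val _ _ _ _ _ _ _); rewrite e0 => /esym/eqP; rewrite subr_eq0 => /eqP ->.
Qed.

(* The boundary point with outer normal of angle t of the body with support
   function [trig k p q r], read as a linear functional applied to (x, y). *)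
Definition support_point k p q r x y t : E :=
  (trig k p q r t * cos t - dtrig k q r t * sin t) *: x +
  (trig k p q r t * sin t + dtrig k q r t * cos t) *: y.

(* A point dominated by the support function lies on a vertical chord between
   two of the points of the curve. *)
Lemma support_hull k p q r a b x y u :
  (forall t, a * cos t + b * sin t <= trig k p q r t) ->
  (forall t, support_point k p q r x y t <= u) -> a *: x + b *: y <= u.
Proof.
move=> h hu.
(* [F] and [G] are the coordinates of the boundary point at [t] relative to (a, b). The signs of [F]
   at 0, pi and - pi give a zero on each half circle. *)
pose F t := trig k p q r t * cos t - dtrig k q r t * sin t - a.
pose G t := trig k p q r t * sin t + dtrig k q r t * cos t - b.
have FC : continuous F.
  move=> t; apply: cvgB; last exact: cvg_cst.
  apply: cvgB; apply: cvgM.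
  - exact: continuous_trig.
  - exact: continuous_cos.
  - exact: continuous_dtrig.
  - exact: continuous_sin.
have F0 : 0 <= F 0 by have := h 0; rewrite /F cos0 sin0; lra.
have Fpi : F pi <= 0 by have := h pi; rewrite /F cospi sinpi; lra.
have FNpi : F (- pi) <= 0 by have := h (- pi); rewrite /F cosN sinN cospi sinpi; lra.
have pi0 := pi_ge0 R.
have [|t1 t1i Ft1] := @IVT _ F 0 pi 0 pi0 (continuous_subspaceT FC).
  by rewrite ge_min le_max F0 ?Fpi ?FNpi ?orbT.
have [||t2 t2i Ft2] := @IVT _ F (- pi) 0 0 _ (continuous_subspaceT FC).
- by lra.
- by rewrite ge_min le_max F0 ?Fpi ?FNpi ?orbT.
(* Where [F] vanishes, G t sin t is the slack in direction t, so [G] has the sign of the sine. If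
   the sine is 0, the slack is 0 and [trig_contact] applies. *)
have key t : F t = 0 -> G t * sin t = trig k p q r t - (a * cos t + b * sin t) /\
    (sin t = 0 -> G t = 0).
  move=> Ft; have cs := cos2Dsin2 t; rewrite /F in Ft.
  have Gs : G t * sin t = trig k p q r t - (a * cos t + b * sin t).
    rewrite /G -[X in _ = X - _]mulr1 -cs.
    have -> : trig k p q r t * (cos t ^+ 2 + sin t ^+ 2) - (a * cos t + b * sin t) =
      (trig k p q r t * sin t + dtrig k q r t * cos t - b) * sin t +
      (trig k p q r t * cos t - dtrig k q r t * sin t - a) * cos t by ring.
    by rewrite Ft mul0r addr0.
  split => // s0; have ht : a * cos t + b * sin t = trig k p q r t.
    by move: Gs; rewrite s0 mulr0; lra.
  have := trig_contact h ht; rewrite s0 mulr0 subr0 /G s0 mulr0 add0r => <-.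
  by rewrite s0 expr0n addr0 in cs; rewrite -mulrA -expr2 cs mulr1 subrr.
have G1 : 0 <= G t1.
  have [Gs G0] := key _ Ft1.
  have /sin_ge0_pi : 0 <= t1 <= pi by rewrite in_itv in t1i.
  rewrite le_eqVlt => /orP[/eqP/esym/G0 -> //|s0].
  by rewrite -(pmulr_lge0 _ s0) Gs subr_ge0.
have G2 : G t2 <= 0.
  have [Gs G0] := key _ Ft2.
  have /sin_ge0_pi : 0 <= - t2 <= pi.
    by rewrite in_itv /= in t2i; case/andP: t2i => *; apply/andP; split; lra.
  rewrite le_eqVlt sinN => /orP[/eqP s0|s0].
    by rewrite G0//; lra.
  by rewrite -oppr_ge0 -(pmulr_lge0 _ s0) mulrNN Gs subr_ge0.
have P1 : support_point k p q r x y t1 = a *: x + (b + G t1) *: y.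
  rewrite /support_point /G; congr (_ *: _ + _ *: _); last by ring.
  by apply/eqP; rewrite -subr_eq0; apply/eqP.
have P2 : support_point k p q r x y t2 = a *: x + (b + G t2) *: y.
  rewrite /support_point /G; congr (_ *: _ + _ *: _); last by ring.
  by apply/eqP; rewrite -subr_eq0; apply/eqP.
have [G10|G10] := eqVneq (G t1) 0.
  by have := hu t1; rewrite P1 G10 addr0.
have G3 : 0 < G t1 - G t2 by rewrite subr_gt0 (le_lt_trans G2)// lt0r G10.
apply: (bl_scale_cancel G3).
(* The weights - G t2 and G t1 cancel the vertical offsets of the two endpoints of the chord. *)
have -> : (G t1 - G t2) *: (a *: x + b *: y) =
    (- G t2) *: support_point k p q r x y t1 + G t1 *: support_point k p q r x y t2.
  by rewrite P1 P2; lmod R E.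
have -> : (G t1 - G t2) *: u = (- G t2) *: u + G t1 *: u by lmod R E.
by apply: bl_lerD; apply: bl_ler_scale; rewrite ?oppr_ge0.
Qed.

End SupportFunctional.

(** * The functional calculus *)

Section SupportFunction.
Local Open Scope classical_set_scope.
Context {R : realType} {E : banachLatticeType R}.
Implicit Types (x y u v w : E) (a b c p q r t : R).

Lemma supremum_isLub (A : set E) :
  A !=set0 -> (exists u, isLub A u) -> isLub A (supremum 0 A).
Proof.
move=> A0 [s hs]; suff -> : supremum 0 A = s by [].
rewrite /supremum; case: ifPn => [/eqP r0|_].
  by case: A0 => z; rewrite r0.
have ss : supremums A s by case: hs.
by apply: (is_subset1_supremums _ ss); apply: (@xgetPex _ 0); exists s.
Qed.

Lemma isLub_uniq (A : set E) u v : isLub A u -> isLub A v -> u = v.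
Proof. by move=> [u1 u2] [v1 v2]; apply/le_anti; rewrite u2// v2. Qed.

(** Monotone completeness speaks of positive increasing nets. Finite joins indexed by lists, shifted
    by [u], form such a net; lists are ordered by the value of their join and directed by
    concatenation. *)
Lemma bounded_family_isLub (I : Type) (F : I -> E) u :
  monotonically_complete E -> inhabited I ->
  (forall i, - u <= F i) -> (forall i, F i <= u) -> exists s, isLub (range F) s.
Proof.
move=> mc [i0] Fge Fle.
have u0 : 0 <= u.
  apply: (bl_scale_cancel (ltr0Sn R 1)); rewrite scaler0.
  have -> : 2 *: u = u - (- u) by lmod R E.
  by rewrite -bl_le_sub (le_trans (Fge i0)).
pose X (s : seq I) := foldr (fun i v => Order.join (F i) v) (- u) s.
have X_le s v : (forall i, F i <= v) -> X s <= v.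
  move=> h; elim: s => [|i s IH] /=; last by rewrite leUx h.
  exact: le_trans (Fge i0) (h i0).
have X_ge s : - u <= X s.
  by elim: s => [|i s IH] //=; apply: le_trans IH _; exact: leUr.
have X_catl s s' : X s <= X (s ++ s').
  elim: s => [|i s IH]; first exact: X_ge.
  by rewrite [X _]/= [X (_ ++ _)]/= leUx leUl (le_trans IH)// leUr.
have X_catr s s' : X s' <= X (s ++ s').
  by elim: s => [|i s IH]//; apply: le_trans IH _; exact: leUr.
have shift v v' : (v + u <= v' + u) = (v <= v').
  by rewrite (bl_le_sub v) (bl_le_sub (v + u)); congr (_ <= _); lmod R E.
have [| | | |s [s1 s2]] := mc (seq I) (fun s s' => X s <= X s') (fun s => X s + u).
- split.
  + exact: (inhabits [::]).
  + by move=> s; exact: lexx.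
  + by move=> s s' s''; exact: le_trans.
  + by move=> s s'; exists (s ++ s').
- by move=> s s'; rewrite shift.
- by move=> s; have := X_ge s; rewrite -shift addNr.
- exists `|u + u| => s; apply: bl_norm_le.
    by have := X_ge s; rewrite -shift addNr.
  by rewrite shift; exact: X_le.
exists (s - u); split.
  move=> _ [i _ <-]; rewrite -shift subrK; apply: (le_trans _ (s1 _ _)); last by exists [:: i].
  by rewrite shift /=; exact: leUl.
move=> v hv; rewrite -shift subrK; apply: s2 => _ [s' _ <-].
by rewrite shift; apply: X_le => i; apply: hv; exists i.
Qed.

Variables (k : R) (x y : E).

(** A bound uniform in [t]; with [support_pointN] it bounds the family on both sides, as
    [bounded_family_isLub] requires. *)
Lemma support_point_le p q r t :
  support_point k p q r x y t <=
  (`|p| + (1 + `|k|) * (`|q| + `|r|)) *: (vabs x + vabs y).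
Proof.
have c1 := cos_max (k * t); have s1 := sin_max (k * t).
have bound (a b : R) : `|a| <= 1 -> `|b| <= 1 ->
    `|trig k p q r t * a + dtrig k q r t * b| <= `|p| + (1 + `|k|) * (`|q| + `|r|).
  move=> a1 b1; apply: le_trans (ler_normD _ _) _.
  rewrite [(1 + _) * _]mulrDl mul1r addrA; apply: lerD; rewrite normrM.
    apply: le_trans (ler_piMr _ a1) _ => //; rewrite /trig.
    apply: le_trans (ler_normD _ _) _; apply: le_trans (lerD (ler_normD _ _) (lexx _)) _.
    by rewrite -addrA !lerD// normrM ler_piMr.
  apply: le_trans (ler_piMr _ b1) _ => //; rewrite /dtrig normrM ler_wpM2l//.
  apply: le_trans (ler_normB _ _) _; rewrite addrC.
  by rewrite lerD// normrM ler_piMr.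
rewrite scalerDr; apply: bl_lerD; apply: le_trans (vabs_scale_le _ _) _;
  rewrite bl_le_sub -scalerBl; apply: bl_scaler_ge0; rewrite ?vabs_ge0// subr_ge0.
  by rewrite -mulrN; apply: bound; rewrite ?normrN ?cos_max ?sin_max.
by apply: bound; rewrite ?cos_max ?sin_max.
Qed.

Lemma support_pointN p q r t :
  support_point k (- p) (- q) (- r) x y t = - support_point k p q r x y t.
Proof. by rewrite /support_point /trig /dtrig; lmod R E. Qed.

Lemma support_pointD p q r p' q' r' t :
  support_point k (p + p') (q + q') (r + r') x y t =
  support_point k p q r x y t + support_point k p' q' r' x y t.
Proof. by rewrite /support_point /trig /dtrig; lmod R E. Qed.

Lemma support_pointZ c p q r t :
  support_point k (c * p) (c * q) (c * r) x y t = c *: support_point k p q r x y t.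
Proof. by rewrite /support_point /trig /dtrig; lmod R E. Qed.

(** For integer [k] and [p] large against [q] and [r], this is the functional calculus at (x, y) of
    the positively homogeneous function that equals [trig k p q r] on the unit circle. *)
Definition support_fun p q r : E := supremum 0 (range (support_point k p q r x y)).

Hypothesis mc : monotonically_complete E.

Lemma support_fun_isLub p q r : isLub (range (support_point k p q r x y)) (support_fun p q r).
Proof.
apply: supremum_isLub; first by exists (support_point k p q r x y 0), 0.
apply: (@bounded_family_isLub _ _
  ((`|p| + (1 + `|k|) * (`|q| + `|r|)) *: (vabs x + vabs y)) mc (inhabits 0)) => t.
  rewrite -[support_point _ _ _ _ _ _ _]opprK -support_pointN; apply: bl_lerN2.
  by apply: le_trans (support_point_le _ _ _ _) _; rewrite !normrN.
exact: support_point_le.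
Qed.

Lemma support_fun_ub p q r t : support_point k p q r x y t <= support_fun p q r.
Proof. by apply: (support_fun_isLub p q r).1; exists t. Qed.

Lemma support_fun_le p q r u :
  (forall t, support_point k p q r x y t <= u) -> support_fun p q r <= u.
Proof. by move=> h; apply: (support_fun_isLub p q r).2 => _ [t _ <-]. Qed.

Lemma support_fun_cmodulus : support_fun 1 0 0 = cmodulus x y.
Proof.
apply: (isLub_uniq _ (cmodulus_isLub x y)); rewrite /rotations.
have := support_fun_isLub 1 0 0; congr (isLub (_ @` _) _); apply/funext => t.
by rewrite /support_point /trig /dtrig; congr (_ *: _ + _ *: _); ring.
Qed.

Lemma support_funZ c p q r : 0 <= c -> support_fun (c * p) (c * q) (c * r) = c *: support_fun p q r.
Proof.
move=> c0; apply/le_anti/andP; split.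
  by apply: support_fun_le => t; rewrite support_pointZ bl_ler_scale// support_fun_ub.
have [->|cn0] := eqVneq c 0.
  rewrite scale0r; have := support_fun_ub (0 * p) (0 * q) (0 * r) 0.
  by rewrite support_pointZ scale0r.
have {cn0}c0 : 0 < c by rewrite lt0r cn0.
have ci : 0 < c^-1 by rewrite invr_gt0.
apply: (bl_scale_cancel ci); rewrite scalerA mulVf ?gt_eqF// scale1r.
apply: support_fun_le => t; apply: (bl_scale_cancel c0).
by rewrite scalerA mulfV ?gt_eqF// scale1r -support_pointZ support_fun_ub.
Qed.

End SupportFunction.

(** * Linearity of the functional calculus in the Fourier coefficients *)

Section Sinusoid.
Context {R : realType} {E : banachLatticeType R}.
Implicit Types (p q r s t : R).
Variables (k : int) (x y : E) (C : R).
Hypothesis mc : monotonically_complete E.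
Hypothesis C1 : 1 <= C.
Hypothesis hC : forall d,
  `|cos (k%:~R * d) - cos d| <= C * (1 - cos d) /\
  `|sin (k%:~R * d) - k%:~R * sin d| <= C * (1 - cos d).

Local Notation U := (support_fun k%:~R x y).

(* [>=]: a sum of two boundary points lies below the support function of the
   Minkowski sum, to which [support_hull] applies. *)
Lemma support_funD p q r p' q' r' :
  2 * C * (`|q| + `|r|) <= p -> 2 * C * (`|q'| + `|r'|) <= p' ->
  U (p + p') (q + q') (r + r') = U p q r + U p' q' r'.
Proof.
move=> h h'; apply/le_anti/andP; split.
  apply: (support_fun_le mc) => t; rewrite support_pointD.
  by apply: bl_lerD; exact: support_fun_ub.
(* [trig_supporting] with d = s - t: the boundary point at [t] satisfies the constraint of every
   direction [s]. *)
have sup_rot q0 p0 r0 t s : 2 * C * (`|q0| + `|r0|) <= p0 ->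
   (trig k%:~R p0 q0 r0 t * cos t - dtrig k%:~R q0 r0 t * sin t) * cos s +
   (trig k%:~R p0 q0 r0 t * sin t + dtrig k%:~R q0 r0 t * cos t) * sin s
   <= trig k%:~R p0 q0 r0 s.
  move=> /(trig_supporting t (s - t) hC); rewrite [t + _]addrC subrK.
  by apply: le_trans; rewrite cosB sinB; lra.
set W := U (p + p') (q + q') (r + r').
have key t t' : support_point k%:~R p q r x y t + support_point k%:~R p' q' r' x y t' <= W.
  rewrite /support_point addrACA -!scalerDl.
  apply: (@support_hull _ _ k%:~R (p + p') (q + q') (r + r')).
    move=> s; have -> : trig k%:~R (p + p') (q + q') (r + r') s =
      trig k%:~R p q r s + trig k%:~R p' q' r' s by rewrite /trig; ring.
    have := lerD (sup_rot q p r t s h) (sup_rot q' p' r' t' s h').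
    by apply: le_trans; lra.
  by move=> t0; exact: support_fun_ub.
have move (u v w : E) : (u <= w - v) = (u + v <= w).
  by rewrite (bl_le_sub u) (bl_le_sub (u + v)); congr (_ <= _); lmod R E.
rewrite -move; apply: (support_fun_le mc) => t; rewrite move addrC -move.
by apply: (support_fun_le mc) => t'; rewrite move addrC.
Qed.

Lemma support_fun_real p : 0 <= p -> U p 0 0 = p *: U 1 0 0.
Proof. by move=> p0; rewrite -support_funZ// !mulr0 mulr1. Qed.

(** On the cone 2C(|q| + |r|) <= p, [U] is additive and positively homogeneous, hence linear. The
    vectors [a] and [b] represent |z| cos (k theta) and |z| sin (k theta), so a + ib is |z| (sgn
    z)^k. *)
Lemma support_fun_sinusoid : exists a b : E, forall q r,
  2 * C * (`|q| + `|r|) <= 1 -> U 1 q r = cmodulus x y + q *: a + r *: b.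
Proof.
rewrite -(support_fun_cmodulus k%:~R x y mc).
have C0 : 0 <= C := le_trans ler01 C1.
pose D := 2 * C; have D0 : 0 <= D by rewrite mulr_ge0.
(* Linearity along one axis, on the boundary of the cone. The value at q = -1 comes from V D 1 + V D
   (-1) = V (2D) 0. *)
have dir (V : R -> R -> E) :
    (forall p p' q q', D * `|q| <= p -> D * `|q'| <= p' -> V (p + p') (q + q') = V p q + V p' q') ->
    (forall c p q, 0 <= c -> V (c * p) (c * q) = c *: V p q) ->
    forall q, V (D * `|q|) q = (D * `|q|) *: V 1 0 + q *: (V D 1 - D *: V 1 0).
  move=> VD VZ q; have [q0|q0] := leP 0 q.
    by rewrite ger0_norm// [D * q]mulrC -[X in V _ X]mulr1 VZ//; lmod R E.
  have hD : V D (- 1) = (2 * D) *: V 1 0 - V D 1.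
    have := VZ (2 * D) 1 0; rewrite mulr1 mulr0 => <-; last by rewrite mulr_ge0.
    apply/eqP; rewrite eq_sym subr_eq; apply/eqP; rewrite -VD ?normrN ?normr1 ?mulr1//.
    by rewrite addNr; congr V; ring.
  have qN : q = - q * -1 by ring.
  rewrite ltr0_norm// [D * _]mulrC [X in V _ X]qN VZ ?oppr_ge0 ?ltW//.
  by rewrite hD; lmod R E.
(* [D] is the least p that the cone allows at (q, r) = (1, 0) or (0, 1); its contribution is
   subtracted again. *)
exists (U D 1 0 - D *: U 1 0 0), (U D 0 1 - D *: U 1 0 0) => q r; rewrite -/D => qr.
have := dir (fun p q => U p q 0); rewrite /= => /(_ _ _ q) hq.
have := dir (fun p r => U p 0 r); rewrite /= => /(_ _ _ r) hr.
have {}hq : U (D * `|q|) q 0 = (D * `|q|) *: U 1 0 0 + q *: (U D 1 0 - D *: U 1 0 0).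
  apply: hq => [p p' q1 q2 h1 h2|c p q1 c0].
    by rewrite -support_funD ?normr0 ?addr0.
  by rewrite -support_funZ// mulr0.
have {}hr : U (D * `|r|) 0 r = (D * `|r|) *: U 1 0 0 + r *: (U D 0 1 - D *: U 1 0 0).
  apply: hr => [p p' q1 q2 h1 h2|c p q1 c0].
    by rewrite -support_funD ?normr0 ?add0r ?addr0.
  by rewrite -support_funZ// mulr0.
(* (1, q, r) is split into one boundary vector of the cone per axis and a nonnegative multiple of
   (1, 0, 0). *)
have -> : U 1 q r = U ((D * `|q| + D * `|r|) + (1 - D * (`|q| + `|r|))) ((q + 0) + 0) ((0 + r) + 0).
  by congr (support_fun _ _ _ _ _ _); ring.
have qr0 : 0 <= 1 - D * (`|q| + `|r|) by rewrite subr_ge0.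
have hqr : D * (`|q + 0| + `|0 + r|) <= D * `|q| + D * `|r|.
  by rewrite addr0 add0r mulrDr.
rewrite (support_funD hqr) ?normr0 ?addr0 ?mulr0//.
rewrite -[q in U _ q]addr0 -[r in U _ _ r]add0r support_funD ?normr0 ?addr0 ?add0r//.
by rewrite hq hr (support_fun_real qr0); lmod R E.
Qed.

End Sinusoid.

(** * Twisted fixed points *)

Section SinusoidalNets.
Local Open Scope classical_set_scope.
Context {R : realType} {E : banachLatticeType R}.
Implicit Types (u w c z : E) (t : R) (v : E * E * E).

Lemma bl_le_comb u w u' w' : u' <= w' -> w - u = w' - u' -> u <= w.
Proof. by rewrite bl_le_sub [u <= w]bl_le_sub => h ->. Qed.

Lemma bl_scale_le (a : R) c u : `|a| <= 1 -> c <= u -> - c <= u -> a *: c <= u.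
Proof.
move=> a1 h1 h2; apply: le_trans (vabs_scale_le _ _) _.
apply: le_trans (vabs_le h1 h2); rewrite bl_le_sub -[X in X - _]scale1r -scalerBl.
by apply: bl_scaler_ge0; rewrite ?vabs_ge0// subr_ge0.
Qed.

(* The triple (w, a, b) stands for the family w + Re (e^{it} (a + ib)). *)
Definition sinusoid v t : E := v.1.1 + cos t *: v.1.2 - sin t *: v.2.

Lemma sinusoid_mean v : sinusoid v 0 + sinusoid v pi = 2 *: v.1.1.
Proof. by rewrite /sinusoid cos0 sin0 cospi sinpi; lmod R E. Qed.

Definition sinusoid_le v v' : Prop := forall t, sinusoid v t <= sinusoid v' t.

Lemma sinusoid_le_mean v v' : sinusoid_le v v' -> v.1.1 <= v'.1.1.
Proof.
move=> h; apply: (bl_scale_cancel (ltr0Sn R 1)).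
by rewrite -!sinusoid_mean; apply: bl_lerD.
Qed.

Lemma sinusoid_le_anti v v' : sinusoid_le v v' -> sinusoid_le v' v -> v = v'.
Proof.
move=> h h'; have e t : sinusoid v t = sinusoid v' t by apply/le_anti; rewrite h h'.
have w : v.1.1 = v'.1.1 by apply/le_anti; rewrite !sinusoid_le_mean.
case: v v' w e {h h'} => [[w a] b] [[w' a'] b'] /= <- e; congr (_, _, _).
  by have := e 0; rewrite /sinusoid /= cos0 sin0 !scale1r !scale0r !subr0 => /addrI.
have := e (pi / 2); rewrite /sinusoid /= cos_pihalf sin_pihalf !scale1r !scale0r !addr0.
by move=> /addrI/oppr_inj.
Qed.

Variables (J : Type) (leJ : J -> J -> Prop).
Hypothesis dJ : directed leJ.

(** Order convergence of [c] to s - W, with error W - w i. For the second bound, take l above i and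
    j: (w j + c j) + (w i - c i) <= 2 w l <= 2W, and then the supremum over j. *)
Lemma net_lub_split (w c : J -> E) (W s : E) :
  increasing_net leJ (fun i => w i + c i) -> increasing_net leJ (fun i => w i - c i) ->
  isLub (range w) W -> isLub (range (fun i => w i + c i)) s ->
  forall i, c i - (s - W) <= W - w i /\ (s - W) - c i <= W - w i.
Proof.
move=> hp hm [W1 W2] [s1 s2] i; split.
  have h : w i + c i <= s by apply: s1; exists i.
  by apply: (bl_le_comb h); lmod R E.
have h : s <= W + W - (w i - c i).
  apply: s2 => _ [j _ <-]; case: dJ => _ _ _ /(_ i j)[l il jl].
  have h1 := hp _ _ jl; have h2 := hm _ _ il.
  have h3 : w l <= W by apply: W1; exists l.
  by apply: (bl_le_comb (bl_lerD (bl_lerD h1 h2) (bl_lerD h3 h3))); lmod R E.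
by apply: (bl_le_comb h); lmod R E.
Qed.

Hypothesis mc : monotonically_complete E.
Hypothesis fatou : fatou_property E.

(** The suprema of the means and of the values at angles 0 and - pi/2 determine a candidate triple.
    By [net_lub_split] the net converges to it at every angle with error a multiple of W - w i,
    whose infimum is 0. The Fatou property bounds the norm of the mean. *)
Lemma sinusoid_net_lub (v : J -> E * E * E) (v0 : E * E * E) (M : R) :
  0 <= v0.1.1 -> (forall i, sinusoid_le v0 (v i)) ->
  (forall i j, leJ i j -> sinusoid_le (v i) (v j)) ->
  (forall i, `|(v i).1.1| <= M) ->
  exists v', [/\ forall i, sinusoid_le (v i) v', `|v'.1.1| <= M &
    forall t z, (forall i, sinusoid (v i) t <= z) -> sinusoid v' t <= z].
Proof.
move=> w00 v0v vinc vM.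
have [[i0] _ _ dir] := dJ.
have w0w i : v0.1.1 <= (v i).1.1 by exact: sinusoid_le_mean.
have w_ge0 i : 0 <= (v i).1.1 by exact: le_trans (w0w i).
have w_inc : increasing_net leJ (fun i => (v i).1.1).
  by move=> i j ij; apply/sinusoid_le_mean/vinc.
have [|W W_lub] := mc dJ w_inc w_ge0; first by exists M.
have WM : `|W| <= M.
  rewrite (fatou dJ w_inc w_ge0 W_lub); apply: ge_sup; first by exists `|(v i0).1.1|, i0.
  by move=> _ [i _ <-].
have lubQ t : exists s, isLub (range (fun i => sinusoid (v i) t)) s.
  have [| | |s [s1 s2]] := mc (x := fun i => sinusoid (v i) t - sinusoid v0 t) dJ.
  - by move=> i j ij; apply: (bl_le_comb (vinc i j ij t)); lmod R E.
  - by move=> i; rewrite -bl_le_sub; exact: v0v.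
  - exists (2 * (`|v0.1.1| + M)) => i.
    (* The differences at [t] and at [t + pi] are both nonnegative and add up to twice the
       difference of the means. *)
    apply: (@le_trans _ _ `|2 *: ((v i).1.1 - v0.1.1)|).
      apply: bl_norm_le; first by rewrite -bl_le_sub; exact: v0v.
      apply: (bl_le_comb (v0v i (t + pi))); rewrite /sinusoid cosDpi sinDpi.
      by lmod R E.
    rewrite normrZ ger0_norm// ler_wpM2l//; apply: le_trans (ler_normB _ _) _.
    by rewrite addrC lerD.
  exists (s + sinusoid v0 t); split.
    move=> _ [i _ <-]; have h : sinusoid (v i) t - sinusoid v0 t <= s by apply: s1; exists i.
    by apply: (bl_le_comb h); lmod R E.
  move=> z hz; have h : s <= z - sinusoid v0 t.
    apply: s2 => _ [i _ <-]; have h : sinusoid (v i) t <= z by apply: hz; exists i.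
    by apply: (bl_le_comb h); lmod R E.
  by apply: (bl_le_comb h); lmod R E.
pose D i := W - (v i).1.1.
have D_ge0 i : 0 <= D i by rewrite /D -bl_le_sub; apply: W_lub.1; exists i.
have D_inf z : (forall i, z <= D i) -> z <= 0.
  move=> h; have h' : W <= W - z.
    by apply: W_lub.2 => _ [i _ <-]; apply: (bl_le_comb (h i)); rewrite /D; lmod R E.
  by apply: (bl_le_comb h'); lmod R E.
have sinusoid0 v1 : sinusoid v1 0 = v1.1.1 + v1.1.2.
  by rewrite /sinusoid cos0 sin0 scale1r scale0r subr0.
have sinusoidpi v1 : sinusoid v1 pi = v1.1.1 - v1.1.2.
  by rewrite /sinusoid cospi sinpi scaleN1r scale0r subr0.
have sinusoidN v1 : sinusoid v1 (- (pi / 2)) = v1.1.1 + v1.2.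
  by rewrite /sinusoid cosN sinN cos_pihalf sin_pihalf scale0r addr0 scaleN1r opprK.
have sinusoidP v1 : sinusoid v1 (pi / 2) = v1.1.1 - v1.2.
  by rewrite /sinusoid cos_pihalf sin_pihalf scale0r addr0 scale1r.
have [A hA] := lubQ 0; have [B hB] := lubQ (- (pi / 2)).
have hA' : isLub (range (fun i => (v i).1.1 + (v i).1.2)) A.
  by move: hA; congr (isLub (_ @` _) _); apply/funext.
have hB' : isLub (range (fun i => (v i).1.1 + (v i).2)) B.
  by move: hB; congr (isLub (_ @` _) _); apply/funext.
have a_le := @net_lub_split _ (fun i => (v i).1.2) _ _ _ _ W_lub hA'.
have b_le := @net_lub_split _ (fun i => (v i).2) _ _ _ _ W_lub hB'.
have {}a_le : forall i, (v i).1.2 - (A - W) <= D i /\ (A - W) - (v i).1.2 <= D i.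
  by apply: a_le => i j ij; rewrite -?sinusoid0 -?sinusoidpi; apply: vinc.
have {}b_le : forall i, (v i).2 - (B - W) <= D i /\ (B - W) - (v i).2 <= D i.
  by apply: b_le => i j ij; rewrite -?sinusoidN -?sinusoidP; apply: vinc.
pose v' : E * E * E := (W, A - W, B - W).
(* The means differ by exactly [D i] and each coefficient contributes at most [D i]: 1 + 2 = 3 in
   one direction, - 1 + 2 = 1 in the other. *)
have near i t : sinusoid v' t <= sinusoid (v i) t + 3 *: D i /\
    sinusoid (v i) t <= sinusoid v' t + D i.
  have [a1 a2] := a_le i; have [b1 b2] := b_le i.
  have ca (c : R) : `|c| <= 1 -> c *: ((A - W) - (v i).1.2) <= D i.
    by move=> c1; apply: bl_scale_le => //; rewrite opprB.
  have cb (c : R) : `|c| <= 1 -> c *: ((B - W) - (v i).2) <= D i.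
    by move=> c1; apply: bl_scale_le => //; rewrite opprB.
  have ncos := cos_max t; have nsin := sin_max t.
  rewrite /sinusoid /v' /=; split.
    have h1 := ca _ ncos; have h2 := cb (- sin t); rewrite normrN in h2.
    by apply: (bl_le_comb (bl_lerD h1 (h2 nsin))); rewrite /D; lmod R E.
  have h1 := ca (- cos t); rewrite normrN in h1; have h2 := cb (sin t) nsin.
  by apply: (bl_le_comb (bl_lerD (h1 ncos) h2)); rewrite /D; lmod R E.
exists v'; split => // [i t|t z hz].
  suff h : sinusoid (v i) t - sinusoid v' t <= 0 by apply: (bl_le_comb h); lmod R E.
  (* Going up to [l] above [i] and [j] replaces the error by [D l], which is at most [D j] for the
     arbitrary [j]. *)
  apply: D_inf => j; have [l il jl] := dir i j.
  have h1 := vinc _ _ il t; have [_ h2] := near l t; have h3 := w_inc _ _ jl.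
  by apply: (bl_le_comb (bl_lerD h1 (bl_lerD h2 h3))); rewrite /D; lmod R E.
suff h : 3^-1 *: (sinusoid v' t - z) <= 0.
  apply: (@bl_scale_cancel _ _ 3^-1); first by rewrite invr_gt0.
  by apply: (bl_le_comb h); lmod R E.
apply: D_inf => i; apply: (@bl_scale_cancel _ _ 3) => //.
rewrite scalerA mulfV ?pnatr_eq0// scale1r.
have [h1 _] := near i t.
by apply: (bl_le_comb (bl_lerD h1 (hz i))); lmod R E.
Qed.

End SinusoidalNets.

(** * Superfixed sinusoids and maximal ones among them *)

Section SinusoidalFixedPoint.
Local Open Scope classical_set_scope.
Context {R : realType} {E : banachLatticeType R}.
Variables (S : R -> E -> E) (kappa : R).
Hypothesis mc : monotonically_complete E.
Hypothesis fatou : fatou_property E.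
Hypothesis S_lin : forall t, 0 <= t -> forall (a : R) u w, S t (a *: u + w) = a *: S t u + S t w.
Hypothesis S_pos : forall t, 0 <= t -> forall u, 0 <= u -> 0 <= S t u.
Hypothesis S_norm : forall t, 0 <= t -> forall u, `|S t u| <= `|u|.
Hypothesis S_comm : forall s t, 0 <= s -> 0 <= t -> forall u, S s (S t u) = S t (S s u).

Lemma mono_of_pos t u w : 0 <= t -> u <= w -> S t u <= S t w.
Proof.
move=> t0 uw; rewrite bl_le_sub; have -> : S t w - S t u = S t (w - u).
  by rewrite addrC -scaleN1r -S_lin// scaleN1r addrC.
by apply: S_pos => //; rewrite -bl_le_sub.
Qed.

(** By [sinusoid_twist] this says that [v] lies below [twist t v] for all t >= 0. Stated angle by
    angle, it passes to suprema of nets. *)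
Definition superfixed (v : E * E * E) : Prop :=
  forall t s, 0 <= t -> sinusoid v (s + kappa * t) <= S t (sinusoid v s).

(* (w, g) is mapped to (S_t w, e^{-i kappa t} S_t g), where g = a + ib. *)
Definition twist (t : R) (v : E * E * E) : E * E * E :=
  (S t v.1.1,
   cos (kappa * t) *: S t v.1.2 + sin (kappa * t) *: S t v.2,
   cos (kappa * t) *: S t v.2 - sin (kappa * t) *: S t v.1.2).

Lemma S_sinusoid t v s : 0 <= t ->
  S t (sinusoid v s) = S t v.1.1 + cos s *: S t v.1.2 - sin s *: S t v.2.
Proof.
move=> t0; rewrite /sinusoid addrC -scaleNr S_lin// [v.1.1 + _]addrC S_lin//.
by lmod R E.
Qed.

Lemma sinusoid_twist t v s : 0 <= t ->
  sinusoid (twist t v) (s + kappa * t) = S t (sinusoid v s).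
Proof.
move=> t0; rewrite S_sinusoid// /sinusoid /twist /= cosD sinD.
have cs := cos2Dsin2 (kappa * t).
transitivity (S t v.1.1
    + (cos s * (cos (kappa * t) ^+ 2 + sin (kappa * t) ^+ 2)) *: S t v.1.2
    - (sin s * (cos (kappa * t) ^+ 2 + sin (kappa * t) ^+ 2)) *: S t v.2).
  by lmod R E.
by rewrite cs !mulr1.
Qed.

Lemma twist_superfixed t v : 0 <= t -> superfixed v -> superfixed (twist t v).
Proof.
move=> t0 sv r s r0; rewrite -(subrK (kappa * t) s) addrAC !sinusoid_twist//.
by rewrite S_comm//; apply: mono_of_pos => //; exact: sv.
Qed.

Lemma superfixed_le_twist t v : 0 <= t -> superfixed v -> sinusoid_le v (twist t v).
Proof.
by move=> t0 sv s; rewrite -(subrK (kappa * t) s) sinusoid_twist//; exact: sv.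
Qed.

(* Zorn: the superfixed sinusoids of mean norm at most that of [v0] are
   inductive, and a maximal one is fixed because the semigroup maps it to a
   larger one. *)
Lemma superfixed_below_fixed (v0 : E * E * E) : 0 <= v0.1.1 -> superfixed v0 ->
  exists v, [/\ sinusoid_le v0 v, `|v.1.1| <= `|v0.1.1| &
    forall t, 0 <= t -> twist t v = v].
Proof.
move=> w00 sv0.
pose P v := [/\ sinusoid_le v0 v, `|v.1.1| <= `|v0.1.1| & superfixed v].
pose T := {v : E * E * E | P v}.
have Pv0 : P v0 by split.
pose leT (a b : T) := `[< sinusoid_le (sval a) (sval b) >].
have leT_refl a : leT a a by apply/asboolP => s; exact: lexx.
have leT_trans a b c : leT a b -> leT b c -> leT a c.
  by move=> /asboolP h1 /asboolP h2; apply/asboolP => s; apply: le_trans (h2 s).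
have leT_anti a b : leT a b -> leT b a -> a = b.
  move=> /asboolP h1 /asboolP h2.
  case: a b h1 h2 => [a Pa] [b Pb] /= h1 h2; have ab := sinusoid_le_anti h1 h2.
  by move: Pa Pb; rewrite ab => Pa Pb; congr exist; exact: Prop_irrelevance.
have chain (A : set T) : total_on A leT -> exists t, forall s, A s -> leT s t.
  (* The empty chain is bounded by [v0]; a nonempty one is read as a net indexed by itself. *)
  move=> Atot; have [[a0 Aa0]|A0] := pselect (exists a, A a); last first.
    by exists (exist _ v0 Pv0) => s As; case: A0; exists s.
  pose J := {a : T | A a}; pose leJ (i j : J) := leT (sval i) (sval j).
  have dJ : directed leJ.
    split; first exact: (inhabits (exist _ a0 Aa0)).
    - by move=> i; exact: leT_refl.
    - by move=> i j l; exact: leT_trans.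
    - move=> [i Ai] [j Aj]; have [ij|ji] := Atot _ _ Ai Aj.
        by exists (exist _ j Aj) => //; exact: leT_refl.
      by exists (exist _ i Ai) => //; exact: leT_refl.
  pose vJ (i : J) : E * E * E := sval (sval i).
  have PJ i : P (vJ i) by exact: (svalP (sval i)).
  have [|i j /asboolP//|i|v' [v'1 v'2 v'3]] :=
    sinusoid_net_lub dJ mc fatou (v := vJ) (M := `|v0.1.1|) w00.
  - by move=> i; case: (PJ i).
  - by case: (PJ i).
  have Pv' : P v'.
    split => //.
      move=> s; have [[i0] _ _ _] := dJ; apply: le_trans (v'1 i0 s).
      by case: (PJ i0).
    (* Each term of the net is below [S t] of itself, hence by monotonicity below [S t] of the
       limit; leastness of [v'] concludes. *)
    move=> t s t0; apply: v'3 => i; apply: (@le_trans _ _ (S t (sinusoid (vJ i) s))).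
      by have [_ _] := PJ i; exact.
    by apply: mono_of_pos => //; exact: v'1.
  exists (exist _ v' Pv') => s As; apply/asboolP.
  exact: (v'1 (exist _ s As)).
have [[v [v1 v2 v3]] vmax] := Zorn leT_refl leT_trans leT_anti chain.
exists v; split => // t t0.
have Pt : P (twist t v).
  split; last exact: twist_superfixed.
    by move=> s; apply: le_trans (v1 s) _; exact: superfixed_le_twist.
  by apply: (le_trans _ v2); exact: S_norm.
have := vmax (exist _ _ Pt) => /(_ _)/(congr1 sval); apply.
by apply/asboolP; exact: superfixed_le_twist.
Qed.

End SinusoidalFixedPoint.

(** * Unimodular eigenvalues and orbits *)

Section UnimodularOrbits.
Local Open Scope classical_set_scope.
Context {R : realType}.
Implicit Types (t u : R).

Definition expi u : R[i] := cos u +i* sin u.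

Lemma expiD u t : expi (u + t) = expi u * expi t.
Proof.
rewrite /expi cosD sinD; apply/eqP; rewrite eq_complex /= eqxx /=.
by rewrite [sin u * _ + _]addrC.
Qed.

Lemma expi0 : expi 0 = 1.
Proof. by rewrite /expi cos0 sin0. Qed.

Lemma normr_expi u : `|expi u| = 1.
Proof. by rewrite normc_def /= cos2Dsin2 sqrtr1. Qed.

Lemma normc_le_ReIm (a b : R) : `|a +i* b| <= (`|a| + `|b|)%:C.
Proof.
rewrite normc_def lecR /= -[X in _ <= X]ger0_norm ?addr_ge0// -sqrtr_sqr.
apply: ler_wsqrtr; rewrite sqrrD !real_normK ?num_real//.
by rewrite -addrA lerD2l lerDr mulrn_wge0 ?mulr_ge0.
Qed.

Lemma sin_sub_le u : `|sin u - u| <= u ^+ 2.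
Proof.
wlog u0 : u / 0 <= u.
  move=> H; have [/H//|u0] := leP 0 u.
  have := H (- u); rewrite sinN sqrrN -opprD normrN; apply.
  by rewrite oppr_ge0 ltW.
have [|c] := @MVT_segment R (fun c => sin c - c) (fun c : R => cos c - 1) 0 u u0.
  by apply: continuous_subspaceT => c; apply: cvgB; [exact: continuous_sin|exact: cvg_id].
rewrite in_itv /= sin0 !subr0 => /andP[c0 cu] ->.
rewrite normrM (ger0_norm u0) expr2 ler_wpM2r//.
by have := cos_lip c 0; rewrite cos0 subr0 (ger0_norm c0) => /le_trans; apply.
Qed.

Lemma cos_sub_le u : `|cos u - 1| <= u ^+ 2.
Proof.
rewrite distrC ger0_norm ?subr_ge0 ?cos_le1//.
have -> : 1 - cos u = 2 * sin (u / 2) ^+ 2.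
  have -> : cos u = cos (u / 2 + u / 2) by congr cos; lra.
  by rewrite cosD -!expr2 cos2sin2; ring.
have := sin_lip (u / 2) 0; rewrite sin0 !subr0 => h.
have := lerXn2r 2 (normr_ge0 _ : _ \is Num.nneg) (normr_ge0 _ : _ \is Num.nneg) h.
rewrite !real_normK ?num_real// expr_div_n => {}h.
by have := sqr_ge0 u; lra.
Qed.

Lemma expi_sub_le u : `|expi u - 1 - (0 +i* u)| <= (2 * u ^+ 2)%:C.
Proof.
have -> : expi u - 1 - (0 +i* u) = (cos u - 1) +i* (sin u - u).
  by apply/eqP; rewrite eq_complex /= !subr0 !eqxx.
apply: le_trans (normc_le_ReIm _ _) _; rewrite lecR.
by have := cos_sub_le u; have := sin_sub_le u; lra.
Qed.

Context {X : normedModType R[i]}.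

Lemma normc_Re (x : X) : `|x| = (complex.Re `|x|)%:C.
Proof. by rewrite RRe_real// ger0_real. Qed.

Lemma Re_normr_ge0 (x : X) : 0 <= complex.Re `|x|.
Proof. by rewrite -ler0c -normc_Re. Qed.

(** Continuity bounds the set under the supremum in [opnorm], so the supremum dominates its members;
    a nonzero [x] is then normalized. *)
Lemma opnorm_contractive (T : {linear X -> X}) :
  continuous T -> opnorm T <= 1 -> forall x, `|T x| <= `|x|.
Proof.
move=> /linear_bounded_continuous/bounded_funP /(_ 1)[M hM] T1 x.
have [->|x0] := eqVneq x 0; first by rewrite linear0.
have nx : `|x|^-1 != 0 by rewrite invr_eq0 normr_eq0.
have nx1 : `| `|x|^-1 *: x| = 1.
  by rewrite normrZ normfV normr_id mulVf// normr_eq0.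
have : complex.Re `|T (`|x|^-1 *: x)| <= 1.
  apply: le_trans T1; apply: ub_le_sup; last by exists (`|x|^-1 *: x) => //=; rewrite nx1.
  exists (complex.Re M) => _ [y /= y1 <-].
  by have := hM _ y1; rewrite lecE => /andP[].
rewrite -lecR -normc_Re linearZ normrZ normfV normr_id.
by rewrite ler_pdivrMl ?normr_gt0// mulr1.
Qed.

Context (T : R -> {linear X -> X}).

Lemma unimodular_orbit_generator (g : X) (kappa : R) :
  (forall t, 0 <= t -> T t g = expi (kappa * t) *: g) ->
  generator T (g, (0 +i* kappa) *: g).
Proof.
move=> Tg; apply/cvgrPdist_lt => e e0 /=.
have eE : e = (complex.Re e)%:C by rewrite RRe_real// gtr0_real.
have e0' : 0 < complex.Re e by rewrite -ltcR -eE.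
(* The error of the difference quotient is at most t (c - 1); the added 1 keeps [c] positive even if
   kappa or g is 0. *)
pose c := 2 * kappa ^+ 2 * complex.Re `|g| + 1.
have c0 : 0 < c.
  by rewrite ltr_pwDr// mulr_ge0 ?Re_normr_ge0// mulr_ge0 ?sqr_ge0.
near=> t.
have t0 : 0 < t by near: t; exact: nbhs_right_gt.
have tc : t < complex.Re e / c by near: t; apply: nbhs_right_lt; rewrite divr_gt0.
have tC : (t%:C : R[i]) != 0 by rewrite eq_complex /= eqxx andbT gt_eqF.
have tVC : ((t^-1)%:C : R[i]) = (t%:C)^-1 by rewrite fmorphV.
rewrite Tg ?ltW// -[X in _ *: (_ - X)]scale1r -scalerBl scalerA -scalerBl normrZ.
have -> : (0 +i* kappa) - (t^-1)%:C * (expi (kappa * t) - 1) =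
    - ((t^-1)%:C * (expi (kappa * t) - 1 - (0 +i* (kappa * t)))).
  have -> : (0 +i* (kappa * t)) = t%:C * (0 +i* kappa) :> R[i].
    by apply/eqP; rewrite eq_complex /= !mul0r mulr0 subr0 addr0 mulrC !eqxx.
  by rewrite tVC; field.
rewrite normrN normrM [`|g|]normc_Re.
apply: (@le_lt_trans _ _ ((t^-1)%:C * (2 * (kappa * t) ^+ 2)%:C * (complex.Re `|g|)%:C)).
  rewrite ler_wpM2r ?ler0c ?Re_normr_ge0//.
  have -> : `|(t^-1)%:C| = (t^-1)%:C :> R[i] by rewrite ger0_norm// ler0c invr_ge0 ltW.
  apply: ler_wpM2l; last exact: expi_sub_le.
  by rewrite ler0c invr_ge0 ltW.
rewrite -!rmorphM eE ltcR /=.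
have -> : t^-1 * (2 * (kappa * t) ^+ 2) * complex.Re `|g| = t * (c - 1).
  by rewrite /c; field; rewrite gt_eqF.
by move: tc; rewrite ltr_pdivlMr// => tc; nra.
Unshelve. all: by end_near. Qed.

(** Over a time step h the orbit and e^{i beta h} f differ by o(h). Since [T] is contractive and the
    factors are unimodular, the errors of n steps of length t / n at most add up, and n o(t / n)
    tends to 0. *)
Lemma generator_unimodular_orbit (f : X) (beta : R) :
  C0_semigroup T -> (forall t, 0 <= t -> forall x, `|T t x| <= `|x|) ->
  generator T (f, (0 +i* beta) *: f) ->
  forall t, 0 <= t -> T t f = expi (beta * t) *: f.
Proof.
move=> [_ T0 TD _] Tle /cvgrPdist_lt Af t.
rewrite le_eqVlt => /orP[/eqP <-|t0]; first by rewrite T0 mulr0 expi0 scale1r.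
pose N := complex.Re `|f|; have N0 : 0 <= N := Re_normr_ge0 f.
have step (e : R) : 0 < e -> \forall h \near 0^'+,
    `|T h f - expi (beta * h) *: f| <= (2 * e * h)%:C.
  (* One e h bounds the error of the difference quotient; h c < e bounds the Taylor remainder of the
     exponential by the other. *)
  move=> e0; pose c := 2 * beta ^+ 2 * N + 1.
  have c0 : 0 < c by rewrite ltr_pwDr// mulr_ge0// mulr_ge0 ?sqr_ge0.
  near=> h.
  have h0 : 0 < h by near: h; exact: nbhs_right_gt.
  have hc : h < e / c by near: h; apply: nbhs_right_lt; rewrite divr_gt0.
  have hC : (h%:C : R[i]) != 0 by rewrite eq_complex /= eqxx andbT gt_eqF.
  have hA : `|(0 +i* beta) *: f - (h^-1)%:C *: (T h f - f)| <= e%:C.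
    by apply: ltW; near: h; apply: Af; rewrite ltcR.
  have -> : T h f - expi (beta * h) *: f =
      - (h%:C *: ((0 +i* beta) *: f - (h^-1)%:C *: (T h f - f))) +
      - ((expi (beta * h) - 1 - (0 +i* (beta * h))) *: f).
    have -> : (0 +i* (beta * h)) = h%:C * (0 +i* beta) :> R[i].
      by apply/eqP; rewrite eq_complex /= !mul0r mulr0 subr0 addr0 mulrC !eqxx.
    have -> : (h^-1)%:C = (h%:C)^-1 :> R[i] by rewrite fmorphV.
    by lmod R[i] X; field.
  apply: le_trans (ler_normD _ _) _; rewrite !normrN !normrZ.
  have -> : `|h%:C| = h%:C :> R[i] by rewrite ger0_norm// ler0c ltW.
  apply: (@le_trans _ _ (h%:C * e%:C + (2 * (beta * h) ^+ 2)%:C * N%:C)).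
    apply: lerD; first by apply: ler_wpM2l => //; rewrite ler0c ltW.
    by rewrite [`|f|]normc_Re; apply: ler_wpM2r; [rewrite ler0c|exact: expi_sub_le].
  rewrite -!rmorphM -rmorphD lecR /=.
  have -> : 2 * (beta * h) ^+ 2 * N = h * (h * (c - 1)) by rewrite /c; ring.
  have : h * c < e by rewrite -ltr_pdivlMr.
  by nra.
have iter (h : R) (m : nat) : 0 <= h ->
    `|T (m%:R * h) f - expi (beta * (m%:R * h)) *: f| <=
    m%:R * `|T h f - expi (beta * h) *: f|.
  move=> h0; elim: m => [|m IH].
    by rewrite !mul0r mulr0 T0 expi0 scale1r subrr normr0.
  have mh : 0 <= m%:R * h by rewrite mulr_ge0.
  rewrite -natr1 [(_ + 1) * h]mulrDl mul1r TD// mulrDr expiD.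
  have -> : T (m%:R * h) (T h f) - (expi (beta * (m%:R * h)) * expi (beta * h)) *: f =
    T (m%:R * h) (T h f - expi (beta * h) *: f) +
    expi (beta * h) *: (T (m%:R * h) f - expi (beta * (m%:R * h)) *: f).
    by rewrite linearB [T _ (_ *: f)]linearZ /= scalerBr scalerA addrA subrK [X in X *: _]mulrC.
  apply: le_trans (ler_normD _ _) _; rewrite -natr1 mulrDl mul1r addrC.
  by apply: lerD; [rewrite normrZ normr_expi mul1r|exact: Tle].
apply/eqP; rewrite -subr_eq0 -normr_eq0 normc_Re eq_complex /= eqxx andbT.
apply/eqP/le_anti/andP; split; last exact: Re_normr_ge0.
apply/ler_addgt0Pr => e e0; rewrite add0r.
(* With this tolerance, n + 1 steps of length t / (n + 1) have total error at most 2 (e / (2t)) t =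
   e. *)
have e0' : 0 < e / (2 * t) by rewrite divr_gt0// mulr_gt0.
have [d /= d0 hd] := step _ e0'.
pose n := Num.truncn (t / d).
have tn : t / n.+1%:R < d.
  rewrite ltr_pdivrMr ?ltr0n// mulrC -ltr_pdivrMr//; exact: truncnS_gt.
have h0 : 0 < t / n.+1%:R by rewrite divr_gt0.
have := hd (t / n.+1%:R); rewrite /= sub0r normrN gtr0_norm// => /(_ tn h0) hh.
have := iter _ n.+1 (ltW h0); rewrite mulrC divfK ?pnatr_eq0// => hi.
rewrite -lecR -normc_Re; apply: le_trans hi _.
apply: le_trans (ler_wpM2l _ hh) _ => //.
have -> : (n.+1%:R : R[i]) = (n.+1%:R)%:C by rewrite rmorph_nat.
have : n.+1%:R != 0 :> R by rewrite pnatr_eq0.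
rewrite -rmorphM lecR /=; move: (n.+1%:R : R) => m m0.
rewrite le_eqVlt; apply/orP; left; apply/eqP; field.
by rewrite m0 gt_eqF.
Unshelve. all: by end_near. Qed.

End UnimodularOrbits.

(** * Positive operators on the complexification and their real parts *)

Section RealPart.
Context {R : realType} {E : banachLatticeType R}.
Local Notation EC := (complexification E).
Implicit Types (t a : R) (u w x y : E).

Lemma complexification_scaleE (l : R[i]) (z : EC) :
  l *: z = (complex.Re l *: z.1 - complex.Im l *: z.2,
            complex.Re l *: z.2 + complex.Im l *: z.1) :> E * E.
Proof. by case: l z => [a b] [x y]. Qed.

Lemma complexification_addE (z w : EC) : z + w = (z.1 + w.1, z.2 + w.2) :> E * E.
Proof. by case: z w => [x y] [x' y']. Qed.

Context (T : {linear EC -> EC}) (T_pos : positive_operator T).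

Definition real_part u : E := (T ((u, 0) : EC)).1.

(** [u] is the difference of the positive vectors [vabs u] and [vabs u - u], whose images have no
    imaginary part. *)
Lemma real_partE u : T ((u, 0) : EC) = (real_part u, 0) :> E * E.
Proof.
have pos v : 0 <= v -> (T ((v, 0) : EC)).2 = 0 by move=> v0; have [] := T_pos (z := (v, 0)).
suff h : (T ((u, 0) : EC)).2 = 0 by rewrite [LHS]surjective_pairing h.
have uE : ((vabs u, 0) : EC) = ((u, 0) : EC) + ((vabs u - u, 0) : EC).
  by rewrite complexification_addE /=; congr pair; lmod R E.
have := pos _ (vabs_ge0 u); rewrite uE linearD complexification_addE /=.
have d0 : 0 <= vabs u - u by rewrite -bl_le_sub vabs_ler.
by rewrite (pos _ d0) addr0.
Qed.

Lemma real_part_ge0 u : 0 <= u -> 0 <= real_part u.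
Proof. by move=> u0; have [] := T_pos (z := (u, 0)). Qed.

Lemma real_part_linear a u w : real_part (a *: u + w) = a *: real_part u + real_part w.
Proof.
have -> : real_part (a *: u + w) = (T (a%:C *: ((u, 0) : EC) + ((w, 0) : EC))).1.
  congr (T _).1; rewrite complexification_addE complexification_scaleE /=.
  by congr pair; lmod R E.
rewrite linearP complexification_addE complexification_scaleE /= real_partE /=.
by rewrite scale0r subr0.
Qed.

Lemma real_part_pair x y : T ((x, y) : EC) = (real_part x, real_part y) :> E * E.
Proof.
have -> : ((x, y) : EC) = ((x, 0) : EC) + (0 +i* 1) *: ((y, 0) : EC).
  by rewrite complexification_addE complexification_scaleE /=; congr pair; lmod R E.
rewrite linearD linearZ complexification_addE /=.
by rewrite !real_partE /=; congr pair; lmod R E.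
Qed.

Lemma real_part_norm u : (forall z : EC, `|T z| <= `|z|) -> `|real_part u| <= `|u|.
Proof.
have e : T (u, 0) = ((real_part u, 0) : EC) := real_partE u.
by move=> /(_ (u, 0)); rewrite e !cnorm_real lecR.
Qed.

End RealPart.

(** * Rotation of the vector against shift of the phase *)

Section RotatedSupport.
Context {R : realType} {E : banachLatticeType R}.
Implicit Types (k eps s t : R) (x y : E).

(** With these coefficients [trig] at [t] is 1 + eps cos (k t + s). *)
Lemma support_point_phase k eps s t x y :
  support_point k 1 (eps * cos s) (- (eps * sin s)) x y t =
  ((1 + eps * cos (k * t + s)) * cos t + k * eps * sin (k * t + s) * sin t) *: x +
  ((1 + eps * cos (k * t + s)) * sin t - k * eps * sin (k * t + s) * cos t) *: y.
Proof. by rewrite /support_point /trig /dtrig cosD sinD; lmod R E. Qed.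

(** Passing from z to e^{ia} z adds [a] to theta, hence k a to the phase of cos (k theta + s). *)
Lemma support_point_rotate k eps s t x y (a : R) :
  support_point k 1 (eps * cos s) (- (eps * sin s))
    (cos a *: x - sin a *: y) (cos a *: y + sin a *: x) t =
  support_point k 1 (eps * cos (s + k * a)) (- (eps * sin (s + k * a))) x y (t - a).
Proof.
rewrite !support_point_phase.
have -> : k * (t - a) + (s + k * a) = k * t + s by ring.
by rewrite cosB sinB; lmod R E.
Qed.

End RotatedSupport.

(** * Eigenvectors for the integer multiples of the eigenvalue *)

Unset Implicit Arguments.
Set Strict Implicit.
Set Printing Implicit Defensive.

Theorem corollary3p5 (R : realType) (E : banachLatticeType R)
    (E_monotonically_complete : monotonically_complete E)
    (E_fatou : fatou_property E)
    (T : R -> {linear complexification E -> complexification E})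
    (T_semigroup : C0_semigroup T)
    (T_positive : forall t : R, 0 <= t -> positive_operator (T t))
    (T_contractive : forall t : R, 0 <= t -> opnorm (T t) <= 1)
    (beta : R)
    (beta_eigenvalue : is_eigenvalue (generator T) (0 +i* beta)) (k : int) :
  is_eigenvalue (generator T) (0 +i* (k%:~R * beta)).
Proof.
have T_le t : 0 <= t -> forall z, `|T t z| <= `|z|.
  by move=> t0; apply: opnorm_contractive; [case: T_semigroup => h _ _ _; exact: h|exact: T_contractive].
have [[x y] f0 /= Af] := beta_eigenvalue.
have Tf := generator_unimodular_orbit T_semigroup T_le Af.
pose S t := real_part (T t).
have S_lin t : 0 <= t -> forall (p : R) u w, S t (p *: u + w) = p *: S t u + S t w.
  by move=> t0; exact: real_part_linear (T_positive t t0).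
have S0 t : S t 0 = 0 by rewrite /S /real_part (linear0 (T t)).
have S_pos t (t0 : 0 <= t) := real_part_ge0 (T_positive t t0).
have S_norm t (t0 : 0 <= t) u : `|S t u| <= `|u|.
  by apply: real_part_norm; [exact: T_positive|exact: T_le].
have S_comm s t : 0 <= s -> 0 <= t -> forall u, S s (S t u) = S t (S s u).
  move=> s0 t0 u; case: T_semigroup => _ _ TD _.
  have TE r (r0 : 0 <= r) w : T r (w, 0) = ((S r w, 0) : complexification E).
    exact: real_partE (T_positive r r0) w.
  have := TD s t s0 t0 (u, 0); rewrite addrC (TD t s t0 s0) !TE//.
  by move=> /(congr1 fst).
have [Sx Sy] : (forall t, 0 <= t -> S t x = cos (beta * t) *: x - sin (beta * t) *: y) /\
    (forall t, 0 <= t -> S t y = cos (beta * t) *: y + sin (beta * t) *: x).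
  by split=> t t0; have := Tf t t0; rewrite (real_part_pair (T_positive t t0)) complexification_scaleE => -[].
have [C C1 hC] := trig_multiple_bound (R := R) k.
have [a [b hab]] := support_fun_sinusoid x y E_monotonically_complete C1 hC.
have C0 : 0 < C := lt_le_trans ltr01 C1.
(* Since |cos s| + |sin s| <= 2, this keeps 2C(|q| + |r|) <= 1 for every phase, as [hab] demands. *)
pose eps := (4 * C)^-1.
have eps0 : 0 < eps by rewrite invr_gt0 mulr_gt0.
pose v0 : E * E * E := (cmodulus x y, eps *: a, eps *: b).
have v0E s : sinusoid v0 s =
    support_fun k%:~R x y 1 (eps * cos s) (- (eps * sin s)).
  rewrite hab; first by rewrite /sinusoid /v0 /=; lmod R E.
  rewrite normrN !normrM (gtr0_norm eps0).
  have := cos_max s; have := sin_max s => h1 h2.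
  have -> : 2 * C * (eps * `|cos s| + eps * `|sin s|) = (`|cos s| + `|sin s|) / 2.
    by rewrite /eps; field; rewrite gt_eqF.
  lra.
pose kappa := k%:~R * beta.
(* By rotation, a support point of (x, y) with phase s + kappa t is one of (S t x, S t y) with phase
   s. It is thus [S t] of a support point of (x, y), which lies below the supremum. *)
have v0_super : superfixed S kappa v0.
  move=> t s t0; rewrite !v0E; apply: (support_fun_le E_monotonically_complete) => r.
  have := support_point_rotate k%:~R eps s (r + beta * t) x y (beta * t).
  rewrite addrK mulrA -/kappa => <-; rewrite -Sx// -Sy//.
  apply: (@le_trans _ _ (S t (support_point k%:~R 1 (eps * cos s) (- (eps * sin s)) x y (r + beta * t)))).
    have SE p q : p *: S t x + q *: S t y = S t (p *: x + q *: y).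
      by rewrite S_lin// -[q *: y]addr0 S_lin// S0 addr0.
    by rewrite /support_point SE.
  apply: (mono_of_pos S_lin S_pos) => //; exact: support_fun_ub.
have [v [v0v vnorm vfix]] := superfixed_below_fixed E_monotonically_complete E_fatou
  S_lin S_pos S_norm S_comm (cmodulus_ge0 x y : 0 <= v0.1.1) v0_super.
exists ((v.1.2, v.2) : complexification E).
  apply: contraNneq f0 => -[a0 b0].
  (* At phase - k r the perturbed radius in direction [r] attains its maximum 1 + eps. *)
  have big r : (1 + eps) *: (cos r *: x + sin r *: y) <= v.1.1.
    have := v0v (- (k%:~R * r)); rewrite /sinusoid a0 b0 !scaler0 addr0 subr0; apply: le_trans.
    rewrite -/(sinusoid v0 _) v0E.
    apply: (le_trans _ (support_fun_ub k%:~R x y E_monotonically_complete _ _ _ r)).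
    by rewrite support_point_phase subrr cos0 sin0 le_eqVlt; apply/orP; left; apply/eqP; lmod R E.
  have le : (1 + eps) *: cmodulus x y <= v.1.1.
    have e1 : 0 < (1 + eps)^-1 by rewrite invr_gt0 addr_gt0.
    apply: (bl_scale_cancel e1); rewrite scalerA mulVf ?scale1r; last by rewrite gt_eqF// addr_gt0.
    apply: cmodulus_le => r; apply: (bl_scale_cancel (c := 1 + eps)); first by rewrite addr_gt0.
    by rewrite [X in _ <= X]scalerA mulfV ?scale1r// gt_eqF// addr_gt0.
  have e0 : 0 <= 1 + eps by rewrite ltW// addr_gt0.
  (* (1 + eps) times the norm of |z| is at most the norm of |z|, so z = 0. *)
  have := le_trans (bl_norm_le (bl_scaler_ge0 e0 (cmodulus_ge0 x y)) le) vnorm.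
  rewrite normrZ (ger0_norm e0) /= mulrDl mul1r -lerBrDl subrr pmulr_rle0// => n0.
  apply/eqP/(@normr0_eq0 _ (complexification E)); rewrite cnormE /=.
  by rewrite (_ : `|cmodulus x y| = 0)//; apply/le_anti; rewrite n0 normr_ge0.
apply: unimodular_orbit_generator => t t0.
rewrite (real_part_pair (T_positive t t0)) complexification_scaleE /=.
have cs := cos2Dsin2 (kappa * t).
have ea := congr1 (fun u => u.1.2) (vfix t t0).
have eb := congr1 snd (vfix t t0).
rewrite /twist /= in ea eb; rewrite -!/(S t _) -!/kappa.
(* The fixed-point equations give the coefficients of [v] as their images rotated by - kappa t;
   cos^2 + sin^2 = 1 inverts this rotation. *)
move: (S t v.1.2) (S t v.2) ea eb => A B <- <-; congr pair.
  by rewrite -[LHS]scale1r -[X in X *: _]cs; lmod R E.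
by rewrite -[LHS]scale1r -[X in X *: _]cs; lmod R E.
Qed.
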